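(* Let $\mathbb{K}$ be $\mathbb{R}$ or $\mathbb{C}$, let $m\ge 2$ be an integer, let $1\le p\le\infty$, and let $m'$ and $p'$ be the conjugate exponents of $m$ and $p$ respectively. Then the $m$th polarization constant $\mathbb{K}(m,p)$ of $L_p$ spaces over $\mathbb{K}$ satisfies \[ \mathbb{K}(m,p)\le \begin{cases} \dfrac{m^{m/p}}{m!} & \text{if } 1\le p\le m',\\[2mm] \dfrac{m^{m/m'}}{m!} & \text{if } m'\le p\le m,\\[2mm] \dfrac{m^{m/p'}}{m!} & \text{if } m\le p\le\infty. \end{cases} \] Moreover, in the case $1\le p\le m'$ the estimate is best possible, i.e. $\mathbb{K}(m,p)=m^{m/p}/m!$.
   Context: Conjugate exponents: $q'=q/(q-1)$ for $1<q<\infty$, $1'=\infty$, $\infty'=1$. For a Banach space $X$ over $\mathbb{K}$, let $\mathcal{L}^s({}^mX;\mathbb{K})$ be the space of continuous symmetric $m$-linear forms $L:X^m\to\mathbb{K}$, with norm $\|L\|=\sup\{|L(x_1,\dots,x_m)|:\|x_i\|\le 1,\ 1\le i\le m\}$. The associated $m$-homogeneous polynomial is $\widehat{L}(x)=L(x,\dots,x)$, with norm $\|\widehat{L}\|=\sup\{|\widehat{L}(x)|:\|x\|\le 1\}$. The $m$th polarization constant of $X$ is \[ \mathbb{K}(m,X)=\inf\{M>0:\ \|L\|\le M\|\widehat{L}\|\ \text{ for all } L\in\mathcal{L}^s({}^mX;\mathbb{K})\}, \] and $\mathbb{K}(m,p)=\sup\{\mathbb{K}(m,L_p(\mu)):\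 \mu \text{ is a measure}\}$, where $L_p(\mu)$ is the space over the scalar field $\mathbb{K}$. *)

(* Defs.v *)
From HB Require Import structures.
From mathcomp Require Import all_boot all_order all_algebra.
From mathcomp Require Import perm generic_quotient ring_quotient.
From mathcomp Require Import all_classical all_reals all_analysis.
From mathcomp Require Import measurable_realfun ess_sup_inf.
From mathcomp Require Import complex.

Set Implicit Arguments.
Unset Strict Implicit.
Unset Printing Implicit Defensive.

Import Order.TTheory GRing.Theory Num.Theory.
Import numFieldTopology.Exports numFieldNormedType.Exports.

Local Open Scope classical_set_scope.
Local Open Scope ring_scope.

Variant scalar_kind := RealScalars | ComplexScalars.

Definition scalars (R : realType) (k : scalar_kind) : numFieldType :=
  match k with
  | RealScalars => R
  | ComplexScalars => R[i]
  end.

Definition re_part (R : realType) (k : scalar_kind) : scalars R k -> R :=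
  match k return scalars R k -> R with
  | RealScalars => idfun
  | ComplexScalars => @complex.Re R
  end.

Definition im_part (R : realType) (k : scalar_kind) : scalars R k -> R :=
  match k return scalars R k -> R with
  | RealScalars => cst 0
  | ComplexScalars => @complex.Im R
  end.

Definition of_real (R : realType) (k : scalar_kind) : R -> scalars R k :=
  match k return R -> scalars R k with
  | RealScalars => idfun
  | ComplexScalars => fun x => Complex x 0
  end.

(* [`|z|] is itself an element of [scalars R k]; [modulus z] is the same number
   seen in [R]. *)
Definition modulus (R : realType) (k : scalar_kind) (z : scalars R k) : R :=
  re_part `|z|.

Section scalars_theory.
Context {R : realType} {k : scalar_kind}.
Implicit Types (x y : R) (z w : scalars R k).

Lemma of_realK : cancel (@of_real R k) (@re_part R k).
Proof. by case: k. Qed.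

Lemma modulusE z : of_real k (modulus z) = `|z|.
Proof. by rewrite /modulus; case: k z => // z; rewrite normc_def. Qed.

Lemma of_realD x y : of_real k (x + y) = of_real k x + of_real k y.
Proof. by case: k => //=; rewrite -[RHS]/(Complex _ _) addr0. Qed.

Lemma of_realM x y : of_real k (x * y) = of_real k x * of_real k y.
Proof.
by case: k => //=; rewrite -[RHS]/(Complex _ _) !mulr0 mul0r subr0 addr0.
Qed.

Lemma of_real0 : of_real k (0 : R) = 0.
Proof. by case: k. Qed.

Lemma ler_of_real x y : (of_real k x <= of_real k y) = (x <= y).
Proof. by case: k => //=; rewrite lecR. Qed.

Lemma of_real_inj : injective (@of_real R k).
Proof. exact: can_inj of_realK. Qed.

Lemma modulus_ge0 z : 0 <= modulus z.
Proof. by rewrite -ler_of_real of_real0 modulusE. Qed.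

Lemma ler_modulusD z w : modulus (z + w) <= modulus z + modulus w.
Proof. by rewrite -ler_of_real of_realD !modulusE ler_normD. Qed.

Lemma modulusM z w : modulus (z * w) = modulus z * modulus w.
Proof. by apply: of_real_inj; rewrite of_realM !modulusE normrM. Qed.

Lemma modulus0 : modulus (0 : scalars R k) = 0.
Proof. by apply: of_real_inj; rewrite modulusE normr0 of_real0. Qed.

Lemma modulus_eq0 z : modulus z = 0 -> z = 0.
Proof. by move=> z0; apply/normr0_eq0; rewrite -modulusE z0 of_real0. Qed.

Lemma modulus_def z :
  modulus z = Num.sqrt (re_part z ^+ 2 + im_part z ^+ 2).
Proof.
rewrite /modulus; case: k z => [z|z]; last by rewrite normc_def.
by rewrite /= expr0n addr0 sqrtr_sqr.
Qed.

Lemma re_partD z w : re_part (z + w) = re_part z + re_part w.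
Proof. by case: k z w => //= -[? ?] [? ?]. Qed.

Lemma im_partD z w : im_part (z + w) = im_part z + im_part w.
Proof. by case: k z w => /= [_ _|[? ?] [? ?]//]; rewrite addr0. Qed.

Lemma re_partM z w :
  re_part (z * w) = re_part z * re_part w - im_part z * im_part w.
Proof. by case: k z w => /= [z w|[? ?] [? ?]//]; rewrite mul0r subr0. Qed.

Lemma im_partM z w :
  im_part (z * w) = re_part z * im_part w + im_part z * re_part w.
Proof. by case: k z w => /= [z w|[? ?] [? ?]//]; rewrite mulr0 mul0r addr0. Qed.

End scalars_theory.

Section Lp_functions.
Context {R : realType} (k : scalar_kind) d {T : measurableType d}.
Variables (mu : {measure set T -> \bar R}) (p : \bar R).
Local Notation K := (scalars R k).

Definition measurable_scalar_fun (f : T -> K) : Prop :=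
  measurable_fun setT (@re_part R k \o f) /\
  measurable_fun setT (@im_part R k \o f).

(* [Lnorm] takes [\bar R]-valued functions, whence the modulus. *)
Definition Lp_fnorm (f : T -> K) : \bar R :=
  Lnorm mu p (fun t => (modulus (f t))%:E).

Definition Lp_pred : {pred T -> K} :=
  mem [set f | measurable_scalar_fun f /\ (Lp_fnorm f < +oo)%E].

End Lp_functions.

Arguments Lp_pred {R} k {d T} mu p.

Section Lp_submodule.
Context {R : realType} (k : scalar_kind) d {T : measurableType d}.
Variables (mu : {measure set T -> \bar R}) (p : \bar R) (p1 : (1 <= p)%E).
Local Notation K := (scalars R k).

Lemma measurable_modulus (f : T -> K) : measurable_scalar_fun f ->
  measurable_fun setT (fun t => modulus (f t)).
Proof.
move=> [mr mi]; under eq_fun do rewrite modulus_def.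
apply: (@measurableT_comp _ _ _ _ _ _ (@Num.sqrt R)).
  by apply: continuous_measurable_fun; exact: sqrt_continuous.
by apply: measurable_funD; apply: measurable_funX.
Qed.

Lemma measurable_scalar_funD (f g : T -> K) : measurable_scalar_fun f ->
  measurable_scalar_fun g -> measurable_scalar_fun (f + g).
Proof.
move=> [mfr mfi] [mgr mgi]; split.
- rewrite (_ : _ \o _ = (@re_part R k \o f) \+ (@re_part R k \o g)).
    exact: measurable_funD.
  by apply/funext => t /=; rewrite -re_partD.
- rewrite (_ : _ \o _ = (@im_part R k \o f) \+ (@im_part R k \o g)).
    exact: measurable_funD.
  by apply/funext => t /=; rewrite -im_partD.
Qed.

Lemma measurable_scalar_funZ (a : K) (f : T -> K) : measurable_scalar_fun f ->
  measurable_scalar_fun (a *: f).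
Proof.
move=> [mfr mfi]; split.
- rewrite (_ : _ \o _ = (fun t => re_part a * re_part (f t)
                                - im_part a * im_part (f t))).
    by apply: measurable_funB; exact: measurable_funM.
  by apply/funext => t /=; rewrite -re_partM.
- rewrite (_ : _ \o _ = (fun t => re_part a * im_part (f t)
                                + im_part a * re_part (f t))).
    by apply: measurable_funD; exact: measurable_funM.
  by apply/funext => t /=; rewrite -im_partM.
Qed.

Lemma Lp_fnorm_ge0 (f : T -> K) : (0 <= Lp_fnorm mu p f)%E.
Proof. exact: Lnorm_ge0. Qed.

Lemma le_Lnorm (f g : T -> R) :
  measurable_fun setT f -> measurable_fun setT g ->
  (forall t, 0 <= f t) -> (forall t, 0 <= g t) ->
  (\forall t \ae mu, f t <= g t) ->
  (Lnorm mu p (EFin \o f) <= Lnorm mu p (EFin \o g))%E.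
Proof.
move=> mf mg f0 g0 fg; rewrite unlock /Lnorm.
case: p p1 => [r| |]// r1.
  have r0 : 0 <= r by move: r1; rewrite lee_fin; exact: le_trans.
  have mpow (h : T -> R) : measurable_fun setT h ->
      measurable_fun setT (fun t => `|(EFin \o h) t| `^ r)%E.
    move=> mh; apply/(@measurable_EFinP _ _ _ _ (fun t => `|h t| `^ r)).
    apply: (@measurableT_comp _ _ _ _ _ _ (fun x : R => x `^ r)) => //.
    exact: measurableT_comp.
  apply: gt0_ler_poweR.
  - by rewrite invr_ge0.
  - by rewrite in_itv/= leey integral_ge0// => t _; exact: poweR_ge0.
  - by rewrite in_itv/= leey integral_ge0// => t _; exact: poweR_ge0.
  - apply: ae_ge0_le_integral => //; [|exact: mpow| |exact: mpow|].
    + by move=> t _; exact: poweR_ge0.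
    + by move=> t _; exact: poweR_ge0.
    + apply: filterS fg => t fgt _ /=; rewrite lee_fin.
      by apply: ge0_ler_powR; rewrite ?nnegrE// !ger0_norm.
case: ifPn => // _; apply: le_ess_sup.
by apply: filterS fg => t fgt /=; rewrite lee_fin !ger0_norm.
Qed.

Lemma le_Lp_fnormD (f g : T -> K) :
  measurable_scalar_fun f -> measurable_scalar_fun g ->
  (Lp_fnorm mu p (f + g)%R <= Lp_fnorm mu p f + Lp_fnorm mu p g)%E.
Proof.
move=> mf mg.
have := eminkowski mu (measurable_modulus mf) (measurable_modulus mg) p1.
apply: le_trans; apply: le_Lnorm => [|||t|].
- exact/measurable_modulus/measurable_scalar_funD.
- by apply: measurable_funD; exact: measurable_modulus.
- by move=> t; exact: modulus_ge0.
- by rewrite addr_ge0// modulus_ge0.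
- by apply/nearW => t; exact: ler_modulusD.
Qed.

Lemma Lp_fnormZ (a : K) (f : T -> K) : f \in Lp_pred k mu p ->
  Lp_fnorm mu p (a *: f) = ((modulus a)%:E * Lp_fnorm mu p f)%E.
Proof.
rewrite inE /= => -[mf fy].
have Lf : (fun t => modulus (f t)) \in Lfun mu p.
  rewrite inE; apply/andP; split; rewrite inE//=.
  exact: measurable_modulus.
have := LnormZ (Lfun_Sub p1 Lf) (modulus a).
rewrite (ger0_norm (modulus_ge0 a)) /Lp_fnorm => <-.
by apply: eq_Lnorm => t /=; rewrite modulusM.
Qed.

Lemma Lp_fnorm_ae (f g : T -> K) :
  measurable_scalar_fun f -> measurable_scalar_fun g ->
  (\forall t \ae mu, f t = g t) -> Lp_fnorm mu p f = Lp_fnorm mu p g.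
Proof.
move=> mf mg fg; apply/eqP; rewrite eq_le.
have mmf := measurable_modulus mf; have mmg := measurable_modulus mg.
have f0 t : 0 <= modulus (f t) by exact: modulus_ge0.
have g0 t : 0 <= modulus (g t) by exact: modulus_ge0.
have fg' : \forall t \ae mu, modulus (f t) <= modulus (g t).
  by apply: filterS fg => t ->.
have gf' : \forall t \ae mu, modulus (g t) <= modulus (f t).
  by apply: filterS fg => t ->.
by apply/andP; split; [exact: (le_Lnorm mmf mmg f0 g0 fg')
                      |exact: (le_Lnorm mmg mmf g0 f0 gf')].
Qed.

Lemma measurable_scalar_fun0 : measurable_scalar_fun (0 : T -> K).
Proof.
split.
- exact: (@measurable_cst _ _ _ _ setT (re_part (0 : K))).
- exact: (@measurable_cst _ _ _ _ setT (im_part (0 : K))).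
Qed.

Lemma Lp_fnorm0 : Lp_fnorm mu p (0 : T -> K) = 0%E.
Proof.
rewrite /Lp_fnorm; under eq_Lnorm do rewrite /= modulus0.
by rewrite [LHS]Lnorm0// gt_eqF// (lt_le_trans _ p1).
Qed.

Lemma Lp_submod_closed : submod_closed (Lp_pred k mu p).
Proof.
split; first by rewrite inE /= Lp_fnorm0; split=> //; exact: measurable_scalar_fun0.
move=> a f g fP gP; have := fP; have := gP; rewrite !inE /= => -[mg gy] [mf fy].
split; first exact/measurable_scalar_funD/mg/measurable_scalar_funZ.
rewrite (le_lt_trans (le_Lp_fnormD (measurable_scalar_funZ _ mf) mg))//.
rewrite lte_add_pinfty// Lp_fnormZ// lte_mul_pinfty// ?lee_fin ?modulus_ge0//.
Qed.

HB.instance Definition _ := GRing.isSubmodClosed.Build _ _ (Lp_pred k mu p)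
  Lp_submod_closed.

Record Lp_fun := LpFun { Lp_val :> T -> K ; Lp_valP : Lp_val \in Lp_pred k mu p }.

HB.instance Definition _ := [isSub for Lp_val].
HB.instance Definition _ := [Choice of Lp_fun by <:].
HB.instance Definition _ := [SubChoice_isSubLmodule of Lp_fun by <:].

Implicit Types f g : Lp_fun.

Lemma Lp_fun_measurable f : measurable_scalar_fun f.
Proof. by have := Lp_valP f; rewrite inE => -[]. Qed.

Lemma Lp_fnorm_fin f : (fine (Lp_fnorm mu p f))%:E = Lp_fnorm mu p f.
Proof.
rewrite fineK// ge0_fin_numE ?Lp_fnorm_ge0//.
by have := Lp_valP f; rewrite inE => -[].
Qed.

Definition Lp_null : {pred Lp_fun} :=
  mem [set f : Lp_fun | \forall t \ae mu, f t = 0].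

Lemma Lp_null_submod_closed : submod_closed Lp_null.
Proof.
split; first by rewrite inE /=; apply/nearW.
move=> a f g; rewrite !inE /=; apply: filterS2 => t ft gt.
by rewrite -[LHS]/(a * f t + g t) ft gt mulr0 addr0.
Qed.

HB.instance Definition _ := GRing.isSubmodClosed.Build _ _ Lp_null
  Lp_null_submod_closed.

Definition Lp : Type := Quotient.quot Lp_null.

HB.instance Definition _ := Choice.on Lp.
HB.instance Definition _ := GRing.Zmodule.on Lp.

Definition Lp_class (f : Lp_fun) : Lp := (\pi_(Quotient.quot Lp_null) f)%qT.

Definition Lp_repr (x : Lp) : Lp_fun :=
  generic_quotient.repr (x : Quotient.quot Lp_null).

Lemma Lp_reprK x : Lp_class (Lp_repr x) = x.
Proof. exact: (@reprK _ (Quotient.quot Lp_null)). Qed.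

Lemma Lp_ind (P : Lp -> Prop) : (forall f, P (Lp_class f)) -> forall x, P x.
Proof. by move=> Pf x; rewrite -[x]Lp_reprK. Qed.

Lemma Lp_classP f g : (\forall t \ae mu, f t = g t) <-> Lp_class f = Lp_class g.
Proof.
have -> : (Lp_class f = Lp_class g) <-> (f - g \in Lp_null).
  by rewrite Quotient.idealrBE; split=> [fg|/eqP//]; apply/eqP.
rewrite inE /=; split; apply: filterS => t.
  by move=> fgt; rewrite -[LHS]/(f t - g t) fgt subrr.
by move/subr0_eq.
Qed.

Lemma Lp_repr_ae f : \forall t \ae mu, Lp_repr (Lp_class f) t = f t.
Proof. by apply/Lp_classP; rewrite Lp_reprK. Qed.

Lemma Lp_classD f g : Lp_class (f + g) = Lp_class f + Lp_class g.
Proof. exact: Quotient.pi_add. Qed.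

Lemma Lp_class0 : Lp_class 0 = 0.
Proof. by apply: (addrI (Lp_class 0)); rewrite -Lp_classD !addr0. Qed.

Definition Lp_scale (a : K) (x : Lp) : Lp := Lp_class (a *: Lp_repr x).

Fact Lp_scaleE a f : Lp_scale a (Lp_class f) = Lp_class (a *: f).
Proof.
apply/Lp_classP; apply: filterS (Lp_repr_ae f) => t ft.
by rewrite -[LHS]/(a * Lp_repr (Lp_class f) t) ft.
Qed.

Fact Lp_scaleA a b x : Lp_scale a (Lp_scale b x) = Lp_scale (a * b) x.
Proof. by elim/Lp_ind: x => f; rewrite !Lp_scaleE scalerA. Qed.

Fact Lp_scale1 : left_id 1 Lp_scale.
Proof. by elim/Lp_ind => f; rewrite Lp_scaleE scale1r. Qed.

Fact Lp_scaleDr : right_distributive Lp_scale +%R.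
Proof.
move=> a; elim/Lp_ind => f; elim/Lp_ind => g.
by rewrite -Lp_classD !Lp_scaleE -Lp_classD scalerDr.
Qed.

Fact Lp_scaleDl x : {morph Lp_scale^~ x : a b / a + b}.
Proof.
move=> a b; elim/Lp_ind: x => f.
by rewrite !Lp_scaleE -Lp_classD scalerDl.
Qed.

HB.instance Definition _ := GRing.Zmodule_isLmodule.Build K Lp
  Lp_scaleA Lp_scale1 Lp_scaleDr Lp_scaleDl.

Lemma Lp_classZ a f : Lp_class (a *: f) = a *: Lp_class f.
Proof. exact/esym/Lp_scaleE. Qed.

Definition Lp_norm (x : Lp) : K := of_real k (fine (Lp_fnorm mu p (Lp_repr x))).

Fact Lp_norm_def f : Lp_norm (Lp_class f) = of_real k (fine (Lp_fnorm mu p f)).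
Proof.
rewrite /Lp_norm; congr (of_real _ (fine _)).
by apply: Lp_fnorm_ae (Lp_repr_ae f); exact: Lp_fun_measurable.
Qed.

Fact ler_Lp_normD x y : Lp_norm (x + y) <= Lp_norm x + Lp_norm y.
Proof.
elim/Lp_ind: x => f; elim/Lp_ind: y => g.
rewrite -Lp_classD !Lp_norm_def -of_realD ler_of_real -lee_fin.
by rewrite EFinD !Lp_fnorm_fin; apply: le_Lp_fnormD; exact: Lp_fun_measurable.
Qed.

Fact Lp_normZ a x : Lp_norm (a *: x) = `|a| * Lp_norm x.
Proof.
elim/Lp_ind: x => f; rewrite -Lp_classZ !Lp_norm_def -modulusE -of_realM.
congr of_real; apply: EFin_inj; rewrite EFinM !Lp_fnorm_fin.
by rewrite -Lp_fnormZ//; exact: Lp_valP.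
Qed.

Fact Lp_norm_eq0 x : Lp_norm x = 0 -> x = 0.
Proof.
elim/Lp_ind: x => f; rewrite Lp_norm_def -(@of_real0 _ k) => /of_real_inj f0.
rewrite -Lp_class0; apply/Lp_classP.
have : Lp_fnorm mu p f = 0%E by rewrite -Lp_fnorm_fin f0.
move/Lnorm_eq0_eq0 => /(_ _ (lt_le_trans lte01 p1)) h.
have {h} := h (proj2 (measurable_EFinP _ _)
  (measurable_modulus (Lp_fun_measurable f))).
by apply: filterS => t /(_ I) [] /modulus_eq0.
Qed.

HB.instance Definition _ := Lmodule_isNormed.Build K Lp
  ler_Lp_normD Lp_normZ Lp_norm_eq0.

Lemma Lp_normE f : `|Lp_class f| = of_real k (fine (Lp_fnorm mu p f)).
Proof. exact: Lp_norm_def. Qed.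

End Lp_submodule.

Arguments Lp {R} k {d T} mu {p} p1.

Section polarization.
Context {R : realType} {k : scalar_kind} (m : nat).
Local Notation K := (scalars R k).
(* No completeness is assumed: the definitions make sense in any normed space. *)
Variable X : normedModType K.

(* [dfwith x i u] is [x] with its [i]-th entry replaced by [u] *)
Definition multilinear (L : ('I_m -> X) -> K) : Prop :=
  forall (x : 'I_m -> X) (i : 'I_m) (a : K) (u v : X),
    L (dfwith x i (a *: u + v)) = a * L (dfwith x i u) + L (dfwith x i v).

Definition symmetric_form (L : ('I_m -> X) -> K) : Prop :=
  forall (s : 'S_m) (x : 'I_m -> X), L (x \o s) = L x.

Definition continuous_symmetric_forms : set (('I_m -> X) -> K) :=
  [set L | [/\ multilinear L, symmetric_form L &
    continuous (L : prod_topology (fun _ : 'I_m => X) -> K)]].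

(* Norms of forms and polynomials, and polarization constants, are taken in
   [\bar R]: the sup and inf below are then meaningful without a finiteness
   or nonemptiness proof. *)
Definition form_norm (L : ('I_m -> X) -> K) : \bar R :=
  ereal_sup [set (modulus (L x))%:E | x in [set x | forall i, `|x i| <= 1]].

Definition polynomial_of (L : ('I_m -> X) -> K) (x : X) : K := L (fun=> x).

Definition polynomial_norm (P : X -> K) : \bar R :=
  ereal_sup [set (modulus (P x))%:E | x in [set x : X | `|x| <= 1]].

Definition polarization_constant : \bar R :=
  ereal_inf [set M%:E | M in [set M : R | 0 < M /\
    forall L, continuous_symmetric_forms L ->
      (form_norm L <= M%:E * polynomial_norm (polynomial_of L))%E]].

End polarization.

Definition Lp_polarization_constant (R : realType) (k : scalar_kind) (m : nat)
    (p : \bar R) (p1 : (1 <= p)%E) : \bar R :=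
  ereal_sup [set c : \bar R |
    exists (d : measure_display) (T : measurableType d)
           (mu : {measure set T -> \bar R}),
      c = polarization_constant m (Lp k mu p1)].

(* Main.v *)
Require Import Defs.
From mathcomp Require Import all_boot all_order all_algebra.
From mathcomp Require Import perm complex.
From mathcomp Require Import all_classical all_reals all_analysis.
From mathcomp Require Import measurable_realfun.
From mathcomp Require Import ring lra.

(* By the polarization formula, [m! |L x|] is at most [||P||] times the mean,
   over all choices of signs [e], of [||sum_i e_i x_i|| ^ m].  For an exponent
   [s >= 2] with conjugate [s'], Clarkson's two-point inequality
     [|z + w|^s + |z - w|^s <= 2 (|z|^s' + |w|^s')^(s-1)],
   iterated over the signs, bounds the L_s mean of [|sum_i e_i a_i|] by the l_s'
   norm of the scalars [a_i].  When [s' <= p <= s] this passes to [L_p]-valued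
   [x_i] by Minkowski's inequality, so that unit vectors give a mean of order
   [s] at most [m ^ (1/s')].  The three cases are [s = p'], [s = m] and [s = p];
   the endpoints [p = 1] and [p = +oo] only need the triangle inequality.

   For the lower bound, the symmetric form on the m-dimensional [l_p] whose
   polynomial is the product of the coordinates takes the value [1 / m!] at the
   canonical basis, while its polynomial has norm at most [m ^ (- m / p)] by the
   arithmetic-geometric mean inequality. *)

Set Implicit Arguments.
Unset Strict Implicit.

Import Order.TTheory GRing.Theory Num.Theory.
Import numFieldTopology.Exports numFieldNormedType.Exports.

Local Open Scope ring_scope.

(** * Convexity of powers and Clarkson's inequality for nonnegative reals *)

Section real_inequalities.
Context {R : realType}.
Implicit Types a b c r s t x y z : R.

Lemma powR_convex r x y t : 1 <= r -> 0 <= x -> 0 <= y -> 0 <= t <= 1 ->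
  (t * x + (1 - t) * y) `^ r <= t * x `^ r + (1 - t) * y `^ r.
Proof.
move=> r1 x0 y0 /andP[t0 t1].
have := @convex_powR R r r1 (Itv01 t0 t1) x y.
rewrite !inE /= !in_itv /= !andbT => /(_ x0 y0).
by rewrite !convRE.
Qed.

Lemma is_derive_powR_affine s b c : 0 < 1 + b * c ->
  is_derive c 1 (fun z => (1 + b * z) `^ s) (s * (1 + b * c) `^ (s - 1) * b).
Proof.
move=> h.
have h1 : is_derive c 1 (cst 1 + b *: id : R -> R) b.
  have d0 : is_derive c 1 (cst 1 : R -> R) 0 by exact: is_derive_cst.
  have d1 : is_derive c 1 (b *: id : R -> R) (b *: 1) by exact: is_deriveZ.
  by have := is_deriveD d0 d1; rewrite add0r /GRing.scale /= mulr1.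
have h2 := is_derive1_powR s h.
exact: (@is_derive1_comp R _ (cst 1 + b *: id : R -> R) _ _ _ h2 h1).
Qed.

(** In the product rule the two terms share the factor [(1 + b * c)]^ (s -
    2)[and their contributions in]b * c [^ (1 - s)] cancel. The factored form makes the sign of the
    derivative readable. *)
Lemma is_derive_friedrichs s b c : 0 < c -> 0 < 1 + b * c ->
  is_derive c 1 (fun z => (1 + b * z `^ (1 - s)) * (1 + b * z) `^ (s - 1))
    ((s - 1) * b * (1 - c `^ (- s)) * (1 + b * c) `^ (s - 2)).
Proof.
move=> c0 bc.
have h1 := is_derive_powR_affine (s - 1) bc.
have h2 := is_derive1_powR (1 - s) c0.
have -> : (fun z => (1 + b * z `^ (1 - s)) * (1 + b * z) `^ (s - 1)) =
  (cst 1 + b *: (fun z => z `^ (1 - s)) : R -> R) *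
  ((fun z => (1 + b * z) `^ (s - 1)) : R -> R) by [].
have d0 : is_derive c 1 (cst 1 : R -> R) 0 by exact: is_derive_cst.
apply: (is_derive_eq (is_deriveM (is_deriveD d0 (is_deriveZ b h2)) h1)).
rewrite /GRing.scale /= !add0r.
rewrite (_ : 1 - s - 1 = - s); last by ring.
rewrite (_ : s - 1 - 1 = s - 2); last by ring.
have -> : (1 + b * c) `^ (s - 1) = (1 + b * c) * (1 + b * c) `^ (s - 2).
  rewrite -{2}(powRr1 (ltW bc)) -powRD ?(gt_eqF bc) ?implybT//.
  by congr (_ `^ _); ring.
rewrite -[(cst 1 + _) c]/(1 + b * c `^ (1 - s)).
have -> : c `^ (1 - s) = c * c `^ (- s).
  by rewrite -{2}(powRr1 (ltW c0)) -powRD ?(gt_eqF c0) ?implybT.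
ring.
Qed.

(* Friedrichs' interpolation: the two sides of the inequality are the values at
   [c = 1] and [c = x `^ (s - 1)^-1] of a function that is nonincreasing in [c]. *)
Lemma clarkson_lt1 s x : 2 <= s -> 0 < x < 1 ->
  (1 + x) `^ s + (1 - x) `^ s <= 2 * (1 + x `^ (s / (s - 1))) `^ (s - 1).
Proof.
move=> s2 /andP[x0 x1].
have s1 : 0 < s - 1 by lra.
pose F b z := (1 + b * z `^ (1 - s)) * (1 + b * z) `^ (s - 1).
pose G b z := (s - 1) * b * (1 - z `^ (- s)) * (1 + b * z) `^ (s - 2).
pose c := x `^ (s - 1)^-1.
have c0 : 0 < c by exact: powR_gt0.
have c1 : c <= 1.
  by rewrite -(powRr0 x) ger_powR ?x0 ?ltW// invr_gt0.
have dF z : z \in `[c, 1] -> is_derive z 1 (F x + F (- x)) (G x z + G (- x) z).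
  rewrite in_itv /= => /andP[cz z1]; have z0 := lt_le_trans c0 cz.
  by apply: is_deriveD; apply: is_derive_friedrichs => //; nra.
have : (F x + F (- x)) 1 <= (F x + F (- x)) c.
  apply: (@ler0_derive1_le_cc _ _ c 1) => //.
  - by move=> z /subset_itv_oo_cc /dF [].
  - move=> z zc; have [_] := dF z (subset_itv_oo_cc zc).
    rewrite derive1E => ->.
    move: zc; rewrite in_itv /= => /andP[cz z1]; have z0 := lt_trans c0 cz.
    have zs : 1 <= z `^ (- s).
      by rewrite powRN invf_ge1 ?powR_gt0// -(powRr0 z) ger_powR ?z0 ?ltW//; lra.
    have xz : (1 - x * z) `^ (s - 2) <= (1 + x * z) `^ (s - 2).
      by apply: ge0_ler_powR; rewrite ?nnegrE; nra.
    (* The sum is minus [(s - 1) * x * (A - 1) * (C - B)], where [A - 1 >= 0] because [z <= 1], and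
       [C - B >= 0] because [s - 2 >= 0]. *)
    suff h : G x z + G (- x) z <= 0 by [].
    rewrite /G mulNr.
    set A := _ `^ (- s) in zs *; set B := (1 - _) `^ _ in xz *.
    set C := _ `^ _ in xz *.
    rewrite -oppr_ge0 (_ : - (_ + _) = (s - 1) * x * ((A - 1) * (C - B))); last by ring.
    by rewrite !mulr_ge0 ?(ltW s1, ltW x0, subr_ge0).
  - apply: derivable_within_continuous => z /dF []//.
  - by rewrite in_itv /= lexx c1.
  - by rewrite in_itv /= lexx c1.
rewrite -[(F x + F (- x)) 1]/(F x 1 + F (- x) 1).
rewrite -[(F x + F (- x)) c]/(F x c + F (- x) c) /F powR1 !mulr1 !mulNr.
(* This is why [c] is chosen so: [F (- x) c] vanishes and the first factor of [F x c] becomes 2. *)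
have cx : c `^ (1 - s) = x^-1.
  rewrite -powRrM (_ : _ * _ = -1) ?powR_inv1 ?ltW//.
  by field; lra.
rewrite cx divff ?gt_eqF// subrr mul0r addr0.
have -> : x * c = x `^ (s / (s - 1)).
  rewrite -{1}(powRr1 (ltW x0)) -powRD ?(gt_eqF x0) ?implybT//.
  by congr (_ `^ _); field; lra.
by rewrite !mulr_powRB1; lra.
Qed.

Lemma clarkson_le1 s x : 2 <= s -> 0 <= x <= 1 ->
  (1 + x) `^ s + (1 - x) `^ s <= 2 * (1 + x `^ (s / (s - 1))) `^ (s - 1).
Proof.
move=> s2 /andP[]; have s1 : 0 < s - 1 by lra.
rewrite le_eqVlt => /predU1P[<- _|x0].
  rewrite addr0 subr0 powR0 ?addr0 ?powR1 ?mulr1//.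
  by rewrite ?mulf_neq0 ?invr_eq0 ?gt_eqF//; lra.
rewrite le_eqVlt => /predU1P[->|x1]; last by apply: clarkson_lt1; rewrite ?x0.
rewrite subrr powR0 ?addr0 ?powR1; last by rewrite gt_eqF//; lra.
by rewrite mulr_powRB1//; lra.
Qed.

(** Both sides are homogeneous of degree [s], so dividing by [x] reduces to the ratio [y / x] in
    [[0, 1]]. *)
Lemma clarkson_nneg s x y : 2 <= s -> 0 <= y <= x ->
  (x + y) `^ s + (x - y) `^ s <=
  2 * (x `^ (s / (s - 1)) + y `^ (s / (s - 1))) `^ (s - 1).
Proof.
move=> s2 /andP[y0 yx]; have s1 : 0 < s - 1 by lra.
have [x0|x0] := ltP 0 x; last first.
  have -> : x = 0 by lra.
  have -> : y = 0 by lra.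
  rewrite subrr addr0 powR0 ?addr0 ?mulr_ge0 ?powR_ge0// gt_eqF//; lra.
have yx1 : 0 <= y / x <= 1 by rewrite divr_ge0 ?ler_pdivrMr ?mul1r//= ltW.
have [yx0 yx_le] := andP yx1.
have -> : x + y = x * (1 + y / x) by field; rewrite gt_eqF.
have -> : x - y = x * (1 - y / x) by field; rewrite gt_eqF.
have -> : x `^ (s / (s - 1)) + y `^ (s / (s - 1)) =
    x `^ (s / (s - 1)) * (1 + (y / x) `^ (s / (s - 1))).
  rewrite mulrDr mulr1 -powRM ?(ltW x0)//; congr (_ + _ `^ _).
  by field; rewrite gt_eqF.
move: yx1 yx0 yx_le; set r := y / x => r01 r0 r1.
have [u0 v0] : 0 <= 1 + r /\ 0 <= 1 - r by lra.
rewrite !(powRM _ (ltW x0))// powRM ?addr_ge0 ?powR_ge0// -powRrM.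
have -> : s / (s - 1) * (s - 1) = s by field; rewrite gt_eqF.
by rewrite -mulrDr mulrCA ler_wpM2l ?powR_ge0// clarkson_le1.
Qed.

(** The points [x] and [y] are the convex combinations of [u] and [v] with weights [t, 1 - t] and
    [1 - t, t]; adding the two convexity inequalities gives the claim. *)
Lemma powR_majorization r x y u v : 1 <= r -> 0 <= v -> v <= x <= u ->
  x + y = u + v -> x `^ r + y `^ r <= u `^ r + v `^ r.
Proof.
move=> r1 v0 /andP[vx xu] E.
have [uv|uv] := ltP v u; last first.
  have -> : x = u by lra.
  have -> : y = v by lra.
  by [].
pose t := (x - v) / (u - v).
have t01 : 0 <= t <= 1.
  by rewrite divr_ge0 ?ler_pdivrMr ?mul1r ?subr_ge0 ?subr_gt0//=; lra.
have [t0 t1] := andP t01.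
have xE : x = t * u + (1 - t) * v by rewrite /t; field; lra.
have yE : y = t * v + (1 - t) * u by lra.
have u0 : 0 <= u by lra.
have := powR_convex r1 u0 v0 t01; have := powR_convex r1 v0 u0 t01.
by rewrite -xE -yE; lra.
Qed.

End real_inequalities.

(** * Clarkson's inequality for real or complex scalars *)

Section scalar_inequalities.
Context {R : realType} {k : scalar_kind}.
Implicit Types (z w : scalars R k) (s : R).

Lemma modulusN z : modulus (- z) = modulus z.
Proof. by apply: (@of_real_inj R k); rewrite !modulusE normrN. Qed.

Lemma sqr_modulus z : modulus z ^+ 2 = re_part z ^+ 2 + im_part z ^+ 2.
Proof. by rewrite modulus_def sqr_sqrtr// addr_ge0// sqr_ge0. Qed.

Lemma modulus_parallelogram z w :
  modulus (z + w) ^+ 2 + modulus (z - w) ^+ 2 =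
  2 * (modulus z ^+ 2 + modulus w ^+ 2).
Proof.
have reN : re_part (- w) = - re_part w.
  by clear; case: k w => // -[].
have imN : im_part (- w) = - im_part w.
  by clear; case: k w => [w|[]//]; rewrite /= oppr0.
by rewrite !sqr_modulus !re_partD !im_partD reN imN; ring.
Qed.

(** By the parallelogram identity the squares of [|z + w|] and [|z - w|] have the same sum as those
    of [|z| + |w|] and [|z| - |w|], and by the triangle inequality the former lie between the
    latter. Majorization with exponent [s / 2] then reduces to the real case. *)
Lemma clarkson z w s : 2 <= s ->
  modulus (z + w) `^ s + modulus (z - w) `^ s <=
  2 * (modulus z `^ (s / (s - 1)) + modulus w `^ (s / (s - 1))) `^ (s - 1).
Proof.
move=> s2; wlog wz : z w / modulus w <= modulus z.
  move=> H; have [/H//|/ltW/H] := leP (modulus w) (modulus z).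
  have -> : w - z = - (z - w) by rewrite opprB.
  by rewrite modulusN (addrC w z) (addrC (modulus w `^ _)).
have z0 := modulus_ge0 z; have w0 := modulus_ge0 w.
apply: le_trans (clarkson_nneg s2 _); last by rewrite w0.
have sqrE (x : R) : 0 <= x -> x `^ s = (x ^+ 2) `^ (s / 2).
  by move=> x0; rewrite -powR_mulrn// -powRrM; congr (_ `^ _); field.
have [zw z_w] : 0 <= modulus z + modulus w /\ 0 <= modulus z - modulus w by lra.
rewrite !sqrE ?modulus_ge0//.
apply: powR_majorization.
- lra.
- exact: sqr_ge0.
- apply/andP; split; rewrite ler_sqr ?nnegrE ?modulus_ge0//.
    rewrite lerBlDr -(modulusN w).
    by rewrite (le_trans _ (ler_modulusD (z + w) (- w))) ?addrK.
  exact: ler_modulusD.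
- by rewrite modulus_parallelogram; ring.
Qed.

End scalar_inequalities.

(** * Young, Hoelder and Minkowski inequalities for finite means *)

Section finite_means.
Context {R : realType} {I : finType}.
Implicit Types (h g : I -> R) (a b r : R).

(** Young's inequality for [a] and [b]^ (r - 1)[: the conjugate exponent]r / (r -
    1)[turns the latter into]b [^ r]. At [r = 1] there is no finite conjugate, and the claim is an
    equality. *)
Lemma young_powR r a b : 1 <= r -> 0 <= a -> 0 <= b ->
  a * b `^ (r - 1) <= r^-1 * a `^ r + (1 - r^-1) * b `^ r.
Proof.
rewrite le_eqVlt => /predU1P[<- a0 _|r1 a0 b0].
  by rewrite subrr powRr0 invr1 subrr mul0r addr0 mulr1 mul1r powRr1.
have r0 : r != 0 by lra.
have r10 : r - 1 != 0 by lra.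
have := @conjugate_powR R a (b `^ (r - 1)) r (r / (r - 1)) a0 (powR_ge0 _ _).
rewrite -powRrM (_ : (r - 1) * (r / (r - 1)) = r); last by field.
move=> /(_ _ _ _)/le_trans; apply.
- lra.
- by rewrite divr_gt0; lra.
- by field; rewrite r0 r10.
- rewrite [X in X + _]mulrC [X in _ + X]mulrC (_ : (_ / (_ - _))^-1 = 1 - r^-1)//.
  by field; rewrite r0 r10.
Qed.

Lemma powR_sum_eq0 r h : 0 < r -> (forall i, 0 <= h i) ->
  \sum_i h i `^ r <= 0 -> forall i, h i = 0.
Proof.
move=> r0 h0 sle0 i; apply: (@powR_eq0_eq0 _ _ r).
have s0 : \sum_i h i `^ r = 0.
  by apply/eqP; rewrite eq_le sle0 sumr_ge0// => j _; exact: powR_ge0.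
have hp j : true -> 0 <= h j `^ r by rewrite powR_ge0.
exact: (psumr_eq0P hp s0).
Qed.

(** Young's inequality applied to [h i / b] and [g i / a], then summed. Bounds [a] and [b] on the
    means of order [r] replace the norms, so that no roots appear. *)
Lemma hoelder_powR r g h a b : 1 <= r -> (forall i, 0 <= g i) ->
    (forall i, 0 <= h i) -> 0 < a -> 0 <= b ->
    \sum_i g i `^ r <= #|I|%:R * a `^ r -> \sum_i h i `^ r <= #|I|%:R * b `^ r ->
  \sum_i h i * g i `^ (r - 1) <= #|I|%:R * (b * a `^ (r - 1)).
Proof.
move=> r1 g0 h0 a0; have r0 : 0 < r by lra.
rewrite le_eqVlt => /predU1P[<- _ sh|b0 sg sh].
  rewrite powR0 ?gt_eqF// mulr0 in sh.
  rewrite big1 ?mul0r ?mulr0// => i _.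
  by rewrite (powR_sum_eq0 r0 h0 sh) mul0r.
have c0 : 0 < b * a `^ (r - 1) by rewrite mulr_gt0 ?powR_gt0.
rewrite -ler_pdivrMr// mulr_suml.
have ap := powR_gt0 r a0; have bp := powR_gt0 r b0.
have ai : 0 <= a^-1 by rewrite invr_ge0 ltW.
have bi : 0 <= b^-1 by rewrite invr_ge0 ltW.
apply: (@le_trans _ _ (\sum_i (r^-1 * (h i `^ r / b `^ r)
                               + (1 - r^-1) * (g i `^ r / a `^ r)))).
  apply: ler_sum => i _.
  have := young_powR r1 (divr_ge0 (h0 i) (ltW b0)) (divr_ge0 (g0 i) (ltW a0)).
  have powV x t : 0 < x -> x^-1 `^ t = (x `^ t)^-1.
    by move=> x0; rewrite -[LHS]/(_ `^ t) -(powR_inv1 (ltW x0)) -powRrM mulN1r powRN.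
  rewrite !powRM// !powV//; apply: le_trans.
  by rewrite invfM; rewrite le_eqVlt; apply/orP; left; apply/eqP; ring.
rewrite big_split/= -!mulr_sumr -!mulr_suml.
have r1i : 0 <= 1 - r^-1 by rewrite subr_ge0 invf_le1.
have ri : 0 <= r^-1 by rewrite invr_ge0 ltW.
have -> : #|I|%:R = r^-1 * #|I|%:R + (1 - r^-1) * #|I|%:R :> R by ring.
by rewrite lerD// ler_wpM2l// ler_pdivrMr.
Qed.

Lemma power_mean r h b : 1 <= r -> (forall i, 0 <= h i) -> 0 <= b ->
  \sum_i h i `^ r <= #|I|%:R * b `^ r -> \sum_i h i <= #|I|%:R * b.
Proof.
move=> r1 h0 b0 sh.
have := @hoelder_powR r (fun=> 1) h 1 b r1 (fun=> ler01) h0 ltr01 b0.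
rewrite powR1 mulr1 sumr_const => /(_ (lexx _) sh).
by under eq_bigr do rewrite mulr1; rewrite mulr1.
Qed.

Lemma powR_sum_le r h : (0 < #|I|)%N -> 1 <= r -> (forall i, 0 <= h i) ->
  (\sum_i h i) `^ r <= #|I|%:R `^ (r - 1) * \sum_i h i `^ r.
Proof.
move=> I0 r1 h0; have r0 : 0 < r by lra.
have N0 : 0 < #|I|%:R :> R by rewrite ltr0n.
have s0 : 0 <= \sum_i h i `^ r by rewrite sumr_ge0// => i _; exact: powR_ge0.
(* The mean of order [r] of [h], for which the hypothesis of [power_mean] is an equality. *)
pose b := (#|I|%:R^-1 * \sum_i h i `^ r) `^ r^-1.
have m0 : 0 <= #|I|%:R^-1 * \sum_i h i `^ r by rewrite mulr_ge0 ?invr_ge0 ?(ltW N0).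
have br : b `^ r = #|I|%:R^-1 * \sum_i h i `^ r.
  by rewrite -powRrM mulVf ?gt_eqF// powRr1.
have := @power_mean r h b r1 h0 (powR_ge0 _ _).
rewrite br mulrA divff ?gt_eqF// mul1r => /(_ (lexx _)) sb.
apply: (@le_trans _ _ ((#|I|%:R * b) `^ r)).
  apply: ge0_ler_powR; rewrite ?nnegrE ?(ltW r0) ?mulr_ge0 ?powR_ge0 ?sumr_ge0//.
rewrite powRM ?powR_ge0 ?(ltW N0)// br mulrA.
rewrite le_eqVlt; apply/orP; left; apply/eqP; congr (_ * _).
rewrite powRB ?(gt_eqF N0) ?implybT// powRr1 ?(ltW N0)//.
Qed.

(** Convexity of the power at [(h i + b) / (a + b)], which is the combination of [h i / a] and 1
    with weights [t = a / (a + b)] and [1 - t]. *)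
Lemma minkowski_cst r h a b : 1 <= r -> (forall i, 0 <= h i) ->
    0 <= a -> 0 <= b -> \sum_i h i `^ r <= #|I|%:R * a `^ r ->
  \sum_i (h i + b) `^ r <= #|I|%:R * (a + b) `^ r.
Proof.
move=> r1 h0; have r0 : 0 < r by lra.
rewrite le_eqVlt => /predU1P[<-|a0] b0 sh.
  rewrite powR0 ?gt_eqF// mulr0 in sh.
  under eq_bigr do rewrite (powR_sum_eq0 r0 h0 sh).
  by rewrite sumr_const mulr_natl.
pose t := a / (a + b); have ab0 : 0 < a + b by lra.
have t01 : 0 <= t <= 1.
  by rewrite divr_ge0 ?ler_pdivrMr ?mul1r//=; lra.
have [t0 t1] := andP t01.
have ai : 0 <= a^-1 by rewrite invr_ge0 ltW.
have pw i : (h i + b) `^ r <=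
    (a + b) `^ r * (t * (h i `^ r / a `^ r) + (1 - t)).
  have -> : h i + b = (a + b) * (t * (h i / a) + (1 - t) * 1).
    by rewrite /t; field; rewrite !gt_eqF.
  rewrite powRM ?(ltW ab0)//; last first.
    by rewrite mulr1 addr_ge0 ?subr_ge0// mulr_ge0// mulr_ge0.
  rewrite ler_wpM2l ?powR_ge0//.
  apply: le_trans (powR_convex r1 (divr_ge0 (h0 i) (ltW a0)) ler01 t01) _.
  rewrite powR1 mulr1 powRM// lerD2r ler_wpM2l// ler_wpM2l ?powR_ge0//.
  by rewrite -(powR_inv1 (ltW a0)) -powRrM mulN1r powRN.
apply: le_trans (ler_sum _ (fun i _ => pw i)) _.
rewrite -mulr_sumr big_split/= -mulr_sumr -mulr_suml sumr_const mulrC.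
rewrite ler_wpM2r ?powR_ge0//.
have -> : #|I|%:R = t * #|I|%:R + (1 - t) * #|I|%:R :> R by ring.
by rewrite -[X in _ + X]mulr_natr lerD// ler_wpM2l// ler_pdivrMr ?powR_gt0.
Qed.

End finite_means.

(** * Choices of signs and the flip of one sign *)

Section signs.
Context {I : finType}.
Local Notation signs := {ffun I -> bool}.
Implicit Types (e : signs) (i j : I).

Definition flip_sign j e : signs := [ffun i => e i (+) (i == j)].

Lemma flip_signK j : involutive (flip_sign j).
Proof. by move=> e; apply/ffunP => i; rewrite !ffunE -addbA addbb addbF. Qed.

Lemma sum_flip_sign (V : nmodType) j (F : signs -> V) :
  \sum_e F (flip_sign j e) = \sum_e F e.
Proof. by rewrite [RHS](reindex_inj (inv_inj (flip_signK j))). Qed.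

Lemma sign_flip (A : pzRingType) i j e :
  (-1) ^+ flip_sign j e i = (if i == j then -1 else 1) * (-1) ^+ e i :> A.
Proof.
rewrite ffunE; case: eqP => _; rewrite ?addbF ?mul1r// addbT.
by case: (e i); rewrite /= ?expr0 ?expr1 ?mulrN1 ?opprK ?mulr1.
Qed.

Lemma sum_sign_flip (A : pzRingType) (V : lmodType A) (r : seq I) (x : I -> V) j e :
  j \notin r ->
  \sum_(i <- r) (-1) ^+ flip_sign j e i *: x i = \sum_(i <- r) (-1) ^+ e i *: x i.
Proof.
move=> jr; apply: eq_big_seq => i ir; rewrite sign_flip.
by case: eqP => [ij|_]; rewrite ?mul1r//; rewrite -ij ir in jr.
Qed.

End signs.

(** * Norms as real numbers *)

Section real_norm.
Context {R : realType} {k : scalar_kind} {X : normedModType (scalars R k)}.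
Implicit Types x y : X.

Definition rnorm x : R := re_part `|x|.

Lemma rnorm_modulus x : rnorm x = modulus `|x|.
Proof. by rewrite /modulus normr_id. Qed.

Lemma of_real_rnorm x : of_real k (rnorm x) = `|x|.
Proof. by rewrite rnorm_modulus modulusE normr_id. Qed.

Lemma rnorm_ge0 x : 0 <= rnorm x.
Proof. by rewrite rnorm_modulus modulus_ge0. Qed.

Lemma rnorm_le1 x : (rnorm x <= 1) = (`|x| <= 1).
Proof.
rewrite -of_real_rnorm -(ler_of_real (k := k)); congr (_ <= _).
by case: k.
Qed.

Lemma ler_rnormD x y : rnorm (x + y) <= rnorm x + rnorm y.
Proof. by rewrite -(ler_of_real (k := k)) of_realD !of_real_rnorm ler_normD. Qed.

Lemma rnormZ a x : rnorm (a *: x) = modulus a * rnorm x.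
Proof.
by apply: (@of_real_inj R k); rewrite of_realM !of_real_rnorm modulusE normrZ.
Qed.

End real_norm.

(** * Rademacher sums of scalars *)

Section rademacher.
Context {R : realType} {k : scalar_kind} {I : finType}.
Local Notation K := (scalars R k).

Lemma modulus_sign (b : bool) (z : K) : modulus ((-1) ^+ b * z) = modulus z.
Proof. by case: b; rewrite ?mulN1r ?modulusN ?mul1r. Qed.

Lemma rademacher_scalar (s : R) (a : I -> K) (r : seq I) : 2 <= s -> uniq r ->
  \sum_(e : {ffun I -> bool}) modulus (\sum_(i <- r) (-1) ^+ e i * a i) `^ s <=
  #|{ffun I -> bool}|%:R * (\sum_(i <- r) modulus (a i) `^ (s / (s - 1))) `^ (s - 1).
Proof.
move=> s2; have s1 : 0 < s - 1 by lra.
have s10 : s - 1 != 0 by rewrite gt_eqF.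
have s0 : s != 0 by rewrite gt_eqF//; lra.
elim: r => [_|j r IH /= /andP[jr /IH {}IH]].
  rewrite big1 ?mulr_ge0 ?powR_ge0// => e _.
  by rewrite big_nil modulus0 powR0.
set q := s / (s - 1).
pose S (e : {ffun I -> bool}) : K := \sum_(i <- r) (-1) ^+ e i * a i.
have Sflip e : S (flip_sign j e) = S e.
  exact: (@sum_sign_flip _ K K^o r a j e jr).
have Splus (e : {ffun I -> bool}) : modulus ((-1) ^+ e j * a j + S e) `^ s +
    modulus ((-1) ^+ flip_sign j e j * a j + S (flip_sign j e)) `^ s <=
    2 * (modulus (S e) `^ q + modulus (a j) `^ q) `^ (s - 1).
  rewrite Sflip sign_flip eqxx mulN1r mulNr.
  rewrite addrC [- _ + _]addrC [_ + S e]addrC addrC.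
  rewrite -(modulus_sign (e j) (a j)).
  exact: clarkson.
have Ssum : \sum_(e : {ffun I -> bool})
      modulus (\sum_(i <- j :: r) (-1) ^+ e i * a i) `^ s <=
    \sum_e (modulus (S e) `^ q + modulus (a j) `^ q) `^ (s - 1).
  (* Doubling the sum counts every [e] once directly and once as a flip. *)
  rewrite -(ler_pM2l (_ : 0 < 2))// !mulr_sumr [X in X <= _](_ : _ =
    \sum_(e : {ffun I -> bool}) (modulus ((-1) ^+ e j * a j + S e) `^ s +
    modulus ((-1) ^+ flip_sign j e j * a j + S (flip_sign j e)) `^ s)).
    exact: ler_sum.
  rewrite big_split/= (sum_flip_sign j
    (fun e : {ffun I -> bool} => modulus ((-1) ^+ e j * a j + S e) `^ s)).
  rewrite -big_split/=; apply: eq_bigr => e _.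
  by rewrite big_cons mulr2n mulrDl !mul1r.
apply: (le_trans Ssum).
rewrite big_cons [X in _ * X `^ _]addrC.
apply: (@minkowski_cst R _ (s - 1) (fun e => modulus (S e) `^ q)) => //.
- lra.
- by move=> e; rewrite powR_ge0.
- by rewrite sumr_ge0// => i _; rewrite powR_ge0.
- exact: powR_ge0.
- rewrite (eq_bigr (fun e => modulus (S e) `^ s)) => [|e _]; first exact: IH.
  by rewrite -powRrM /q mulfVK.
Qed.

End rademacher.

(** * Integration of finite sums *)

Section integral_of_sums.
Context {R : realType} {d} {T : measurableType d} (mu : {measure set T -> \bar R}).

Lemma integral_sum_fin (I : finType) (g : I -> T -> R) (a : I -> R) (w : I -> R) :
  (forall i, measurable_fun setT (g i)) -> (forall i t, 0 <= g i t) ->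
  (forall i, 0 <= w i) ->
  (forall i, \int[mu]_t (g i t)%:E = (a i)%:E)%E ->
  (\int[mu]_t (\sum_i w i * g i t)%:E = (\sum_i w i * a i)%:E)%E.
Proof.
move=> mg g0 w0 ga.
under eq_integral do rewrite -sumEFin.
rewrite ge0_integral_sum//; last 2 first.
- move=> i; apply/measurable_EFinP; exact: measurable_funM.
- by move=> i t _; rewrite lee_fin mulr_ge0.
rewrite -sumEFin; apply: eq_bigr => i _.
under eq_integral do rewrite EFinM.
rewrite ge0_integralZl_EFin ?ga ?EFinM//.
- by move=> t _; rewrite lee_fin.
- exact/measurable_EFinP.
Qed.

(** The integrals are supplied as reals [a] and [b], so that monotonicity of the integral yields an
    inequality in [R]. *)
Lemma le_sum_integral (I J : finType) (g : I -> T -> R) (h : J -> T -> R)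
    (a w : I -> R) (b v : J -> R) :
  (forall i, measurable_fun setT (g i)) -> (forall i t, 0 <= g i t) ->
  (forall i, 0 <= w i) -> (forall i, \int[mu]_t (g i t)%:E = (a i)%:E)%E ->
  (forall j, measurable_fun setT (h j)) -> (forall j t, 0 <= h j t) ->
  (forall j, 0 <= v j) -> (forall j, \int[mu]_t (h j t)%:E = (b j)%:E)%E ->
  (forall t, \sum_i w i * g i t <= \sum_j v j * h j t) ->
  \sum_i w i * a i <= \sum_j v j * b j.
Proof.
move=> mg g0 w0 ga mh h0 v0 hb gh.
rewrite -lee_fin -(integral_sum_fin mg g0 w0 ga) -(integral_sum_fin mh h0 v0 hb).
apply: ge0_le_integral => //.
- by move=> t _; rewrite lee_fin sumr_ge0// => i _; rewrite mulr_ge0.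
- apply/measurable_EFinP; apply: measurable_sum => i; exact: measurable_funM.
- apply/measurable_EFinP; apply: measurable_sum => i; exact: measurable_funM.
- by move=> t _; rewrite lee_fin.
Qed.

End integral_of_sums.

(** * Rademacher sums of unit vectors in L_p *)

Section Lp_rademacher.
Context {R : realType} {k : scalar_kind} {d} {T : measurableType d}.
Variable mu : {measure set T -> \bar R}.
Local Notation K := (scalars R k).

(** The representative agrees with the combination of the [Lp_repr (x i)] at every point, not just
    almost everywhere, so scalar inequalities apply pointwise. *)
Lemma Lp_sum_repr (p : \bar R) (p1 : (1 <= p)%E) (I : Type) (r : seq I)
    (c : I -> K) (x : I -> Lp k mu p1) :
  exists2 g : Lp_fun k mu p, \sum_(i <- r) c i *: x i = Lp_class p1 g &
    forall t, g t = \sum_(i <- r) c i * Lp_repr (x i) t.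
Proof.
elim: r => [|i r [g gE gt]].
  eexists; first by rewrite big_nil -Lp_class0.
  by move=> t; rewrite big_nil.
eexists; first by rewrite big_cons -(Lp_reprK (x i)) gE -Lp_classZ -Lp_classD.
by move=> t; rewrite big_cons -gt.
Qed.

Lemma Lp_rnormE (p : \bar R) (p1 : (1 <= p)%E) (f : Lp_fun k mu p) :
  rnorm (Lp_class p1 f) = fine (Lp_fnorm mu p f).
Proof. by rewrite /rnorm Lp_normE of_realK. Qed.

Variables (p : R) (p1 : (1 <= p%:E)%E).

Lemma integral_Lp (f : Lp_fun k mu p%:E) :
  (\int[mu]_t (modulus (f t) `^ p)%:E = (rnorm (Lp_class p1 f) `^ p)%:E)%E.
Proof.
have p0 : p != 0 by rewrite gt_eqF// (lt_le_trans ltr01).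
rewrite -poweR_EFin Lp_rnormE Lp_fnorm_fin.
rewrite (poweR_Lnorm mu (fun t => (modulus (f t))%:E) p0).
by apply: eq_integral => t _; rewrite poweR_EFin ger0_norm ?modulus_ge0.
Qed.

(** The scalar estimate holds at each [t]. The condition [s' <= p] allows passing from the exponent
    [q = s'] to [p] inside the sum, and [p <= s] gives the exponent [r = s / p >= 1] for Minkowski's
    inequality. *)
Lemma Lp_rademacher (I : finType) (s : R) (x : I -> Lp k mu p1) :
  (0 < #|I|)%N -> 2 <= s -> s / (s - 1) <= p -> p <= s ->
  (forall i, rnorm (x i) <= 1) ->
  \sum_(e : {ffun I -> bool}) rnorm (\sum_i (-1) ^+ e i *: x i) `^ s <=
  #|{ffun I -> bool}|%:R * #|I|%:R `^ (s - 1).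
Proof.
move=> I0 s2 qp ps x1; set N := #|{ffun I -> bool}|.
have p_ge1 : 1 <= p by [].
set q := s / (s - 1) in qp.
have s1 : 0 < s - 1 by lra.
have q0 : 0 < q by rewrite divr_gt0//; lra.
have p0 : 0 < p by lra.
have N0 : 0 < N%:R :> R by rewrite ltr0n /N card_ffun card_bool expn_gt0.
have n0 : 0 < #|I|%:R :> R by rewrite ltr0n.
pose f i := Lp_repr (x i).
have [F FE Ft] : exists2 F : {ffun I -> bool} -> Lp_fun k mu p%:E,
    forall e : {ffun I -> bool}, \sum_i (-1) ^+ e i *: x i = Lp_class p1 (F e) &
    forall (e : {ffun I -> bool}) t, F e t = \sum_i (-1) ^+ e i * f i t.
  have h (e : {ffun I -> bool}) :=
    cid2 (Lp_sum_repr (index_enum I) (fun i => (-1) ^+ e i) x).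
  exists (fun e => s2val (h e)) => e; last exact: (s2valP' (h e)).
  exact: (s2valP (h e)).
pose r := s / p; have r1 : 1 <= r by rewrite ler_pdivlMr// mul1r.
pose Y (e : {ffun I -> bool}) := rnorm (\sum_i (-1) ^+ e i *: x i).
have YE e : Y e = rnorm (Lp_class p1 (F e)) by rewrite /Y FE.
(* The constant of [powR_sum_le] at exponent [p / q]: it bounds [(\sum_i |f i t|]^ q) [^ (p / q)] by
   [B t]. *)
pose c := #|I|%:R `^ (p / q - 1) : R.
have pq1 : 1 <= p / q by rewrite ler_pdivlMr// mul1r.
pose B t := \sum_i c * modulus (f i t) `^ p.
have B0 t : 0 <= B t by rewrite sumr_ge0// => i _; rewrite mulr_ge0 ?powR_ge0.
have hB t : \sum_e (modulus (F e t) `^ p) `^ r <= N%:R * B t `^ r.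
  have -> : \sum_e (modulus (F e t) `^ p) `^ r =
      \sum_(e : {ffun I -> bool}) modulus (\sum_i (-1) ^+ e i * f i t) `^ s.
    apply: eq_bigr => e _; rewrite -powRrM Ft; congr (_ `^ _).
    by rewrite /r; field; rewrite gt_eqF.
  apply: le_trans (rademacher_scalar _ s2 (index_enum_uniq I)) _.
  rewrite ler_wpM2l// -/q.
  have -> : s - 1 = p / q * r.
    by rewrite /r /q; field; rewrite !gt_eqF//; lra.
  rewrite powRrM; apply: ge0_ler_powR; rewrite ?nnegrE ?powR_ge0//; first lra.
  apply: le_trans (powR_sum_le I0 pq1 _) _ => [i|]; first exact: powR_ge0.
  rewrite mulr_sumr; apply: ler_sum => i _; rewrite -powRrM mulrCA divff ?mulr1//.
  by rewrite gt_eqF.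
pose W := \sum_e Y e `^ s.
have [W0|W0] := leP W 0; first by rewrite (le_trans W0)// mulr_ge0 ?powR_ge0.
(* The mean of order [r] of the [Y e]^ p[, so that]hY[below is an equality; it is positive
   since]W[is, which later allows cancelling]a [^ (r - 1)]. *)
pose a := (W / N%:R) `^ r^-1.
have a0 : 0 < a by rewrite powR_gt0// divr_gt0.
have r0 : r != 0 by rewrite gt_eqF//; lra.
have ar : a `^ r = W / N%:R.
  by rewrite -powRrM mulVf// powRr1// divr_ge0// ltW.
have Yr e : (Y e `^ p) `^ r = Y e `^ s.
  by rewrite -powRrM; congr (_ `^ _); rewrite /r; field; rewrite gt_eqF.
have hY : \sum_e (Y e `^ p) `^ r <= N%:R * a `^ r.
  rewrite ar mulrCA divff ?gt_eqF// mulr1.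
  by under eq_bigr do rewrite Yr.
have mF (g : Lp_fun k mu p%:E) : measurable_fun setT (fun t => modulus (g t) `^ p).
  apply: (@measurableT_comp _ _ _ _ _ _ (fun y : R => y `^ p)) => //.
  exact: measurable_modulus (Lp_fun_measurable g).
(* Minkowski's inequality by duality: Hoelder's inequality over the signs against
   the weights [(Y e `^ p) `^ (r - 1)], integrated over [T]. *)
have main : \sum_e (Y e `^ p) `^ (r - 1) * (Y e `^ p) <=
    \sum_i (N%:R * a `^ (r - 1) * c) * (rnorm (x i) `^ p).
  apply: (@le_sum_integral _ _ _ mu _ _ (fun e t => modulus (F e t) `^ p)
    (fun i t => modulus (f i t) `^ p)).
  - by move=> e; exact: mF.
  - by move=> e t; exact: powR_ge0.
  - by move=> e; exact: powR_ge0.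
  - by move=> e; rewrite integral_Lp YE.
  - by move=> e; exact: mF.
  - by move=> e t; exact: powR_ge0.
  - by move=> e; rewrite !mulr_ge0 ?powR_ge0.
  - by move=> i; rewrite integral_Lp Lp_reprK.
  move=> t; have := @hoelder_powR _ _ r (fun e => Y e `^ p)
    (fun e => modulus (F e t) `^ p) a (B t) r1 (fun=> powR_ge0 _ _)
    (fun=> powR_ge0 _ _) a0 (B0 t) hY (hB t).
  under eq_bigr do rewrite mulrC.
  move=> /le_trans; apply; rewrite le_eqVlt; apply/orP; left; apply/eqP.
  by rewrite /B mulrCA mulr_suml; apply: eq_bigr => i _; ring.
suff : W <= N%:R * #|I|%:R `^ (s - 1) by [].
have {main} : W <= N%:R * a `^ (r - 1) * #|I|%:R `^ (p / q).
  apply: (le_trans (_ : W <= \sum_e (Y e `^ p) `^ (r - 1) * (Y e `^ p))).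
    by apply: ler_sum => e _; rewrite mulrC mulr_powRB1 ?powR_ge0 ?Yr//; lra.
  apply: (le_trans main).
  apply: (@le_trans _ _ (\sum_(i : I) (N%:R * a `^ (r - 1) * c))).
    apply: ler_sum => i _; rewrite -[leRHS]mulr1 ler_wpM2l ?mulr_ge0 ?powR_ge0//.
    have <- : (1 : R) `^ p = 1 by rewrite powR1.
    by rewrite ge0_ler_powR ?nnegrE ?rnorm_ge0//; lra.
  rewrite sumr_const -[leLHS]mulr_natr -[leLHS]mulrA ler_wpM2l ?mulr_ge0 ?powR_ge0//.
  by rewrite mulrC /c mulr_powRB1//; lra.
have -> : W = N%:R * a `^ (r - 1) * a.
  rewrite -mulrA [_ * a]mulrC mulr_powRB1 ?(ltW a0)// ?ar; last lra.
  by field; rewrite gt_eqF.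
rewrite ler_pM2l ?(mulr_gt0 N0) ?(powR_gt0 _ a0)// => aD.
have -> : N%:R * a `^ (r - 1) * a = N%:R * a `^ r.
  by rewrite -mulrA [_ * a]mulrC mulr_powRB1 ?(ltW a0)//; lra.
rewrite ler_wpM2l//.
have -> : s - 1 = p / q * r.
  by rewrite /r /q; field; rewrite !gt_eqF//; lra.
rewrite powRrM; apply: ge0_ler_powR; rewrite ?nnegrE ?powR_ge0//; lra.
Qed.

End Lp_rademacher.

(** * Expansion of multilinear forms *)

Section multilinear_forms.
Context {R : realType} {k : scalar_kind} {m : nat} {X : normedModType (scalars R k)}.
Local Notation K := (scalars R k).
Variable L : ('I_m -> X) -> K.
Hypothesis mL : multilinear L.
Implicit Types (x y : 'I_m -> X) (i : 'I_m).

Lemma multilinearD x i u v :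
  L (dfwith x i (u + v)) = L (dfwith x i u) + L (dfwith x i v).
Proof. by have := mL x i 1 u v; rewrite scale1r mul1r. Qed.

Lemma multilinear0 x i : L (dfwith x i 0) = 0.
Proof. by apply: (addrI (L (dfwith x i 0))); rewrite -multilinearD !addr0. Qed.

Lemma multilinearZ x i a u : L (dfwith x i (a *: u)) = a * L (dfwith x i u).
Proof. by have := mL x i a u 0; rewrite addr0 multilinear0 addr0. Qed.

Lemma multilinear_sum x i (J : Type) (r : seq J) (g : J -> X) :
  L (dfwith x i (\sum_(j <- r) g j)) = \sum_(j <- r) L (dfwith x i (g j)).
Proof.
elim: r => [|j r IH]; first by rewrite !big_nil multilinear0.
by rewrite !big_cons multilinearD IH.
Qed.

Lemma multilinear_scale (r : seq 'I_m) (c : 'I_m -> K) x : uniq r ->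
  L (fun i => if i \in r then c i *: x i else x i) = \prod_(i <- r) c i * L x.
Proof.
elim: r => [_|j r IH /= /andP[jr /IH {}IH]].
  by rewrite big_nil mul1r.
rewrite big_cons -mulrA -IH; set z := fun i => if i \in r then _ else _.
have zE u : (fun i => if i == j then u else z i) = dfwith z j u.
  apply/funext => i; have [->|ij] := eqVneq i j; first by rewrite dfwithin.
  by rewrite dfwithout// eq_sym.
have -> : z = dfwith z j (x j).
  by rewrite -zE; apply/funext => i; case: eqP => // ->; rewrite /z (negbTE jr).
rewrite -multilinearZ; congr L; rewrite -zE; apply/funext => i.
by rewrite in_cons; case: eqP => [->|].
Qed.

Lemma sum_ffun_update (J : finType) (V : nmodType) i (G : {ffun 'I_m -> J} -> V) :
  \sum_(f : {ffun 'I_m -> J}) \sum_j G [ffun i' => if i' == i then j else f i'] =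
  (\sum_f G f) *+ #|J|.
Proof.
rewrite -sumrMnl; under [RHS]eq_bigr do rewrite -sumr_const.
rewrite !pair_bigA /=.
(* Swapping [f i] with [j] is an involution on the pairs [(f, j)]. *)
pose u (fj : {ffun 'I_m -> J} * J) :=
  ([ffun i' => if i' == i then fj.2 else fj.1 i'] : {ffun 'I_m -> J}, fj.1 i).
have uK : involutive u.
  move=> [f j]; rewrite /u /= ffunE eqxx; congr (_, _).
  by apply/ffunP => i'; rewrite !ffunE; case: eqP => // ->.
by rewrite [RHS](reindex_inj (inv_inj uK)).
Qed.

(** Linearity opens one slot of [r] at a time. The sum runs over functions on all slots, so each
    choice on [r] is repeated; the multiplicities on the two sides account for this without
    division. *)
Lemma multilinear_expand (J : finType) (r : seq 'I_m) (g : 'I_m -> J -> X) y :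
  uniq r ->
  (\sum_(f : {ffun 'I_m -> J})
      L (fun i => if i \in r then g i (f i) else y i)) *+ #|J| ^ size r =
  L (fun i => if i \in r then \sum_j g i j else y i) *+ #|{ffun 'I_m -> J}|.
Proof.
elim: r y => [|i0 r IH] y /=; first by move=> _; rewrite sumr_const.
move=> /andP[i0r ur].
(* For the induction hypothesis, slot [i0] joins the fixed arguments, filled with its whole sum. *)
pose y' := dfwith y i0 (\sum_j g i0 j).
have split_fun (h : 'I_m -> X) u :
    (fun i => if i \in i0 :: r then (if i == i0 then u else h i) else y i) =
    dfwith (fun i => if i \in r then h i else y i) i0 u.
  apply/funext => i; rewrite in_cons.
  have [->|ii0] := eqVneq i i0; first by rewrite dfwithin.
  by rewrite dfwithout// eq_sym.
have y'E (h : 'I_m -> X) : (fun i => if i \in r then h i else y' i) =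
    dfwith (fun i => if i \in r then h i else y i) i0 (\sum_j g i0 j).
  apply/funext => i; rewrite /y'; have [->|ii0] := eqVneq i i0.
    by rewrite (negbTE i0r) !dfwithin.
  by rewrite !dfwithout 1?eq_sym.
rewrite expnS mulnC mulrnA mulrnAC -(sum_ffun_update i0) /=.
have -> : \sum_(f : {ffun 'I_m -> J}) \sum_j L (fun i => if i \in i0 :: r
      then g i ([ffun i' => if i' == i0 then j else f i'] i) else y i) =
    \sum_(f : {ffun 'I_m -> J}) L (fun i => if i \in r then g i (f i) else y' i).
  apply: eq_bigr => f _; rewrite y'E multilinear_sum; apply: eq_bigr => j _.
  rewrite -split_fun; congr L; apply/funext => i; rewrite ffunE.
  by case: eqP => [->|].
rewrite IH// y'E -split_fun; congr (L _ *+ _); apply/funext => i.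
by case: eqP => [->|].
Qed.

Lemma multilinear_sum_all (J : finType) (g : 'I_m -> J -> X) : (0 < #|J|)%N ->
  L (fun i => \sum_j g i j) = \sum_(f : {ffun 'I_m -> J}) L (fun i => g i (f i)).
Proof.
move=> J0; have := multilinear_expand g (fun=> 0) (enum_uniq 'I_m).
have inE (A B : 'I_m -> X) : (fun i => if i \in enum 'I_m then A i else B i) = A.
  by apply/funext => i; rewrite mem_enum.
rewrite inE; under eq_bigr do rewrite inE.
rewrite card_ffun size_enum_ord card_ord => /pmulrnI -> //.
by rewrite expn_gt0 J0.
Qed.

Lemma multilinear_scale_all (c : 'I_m -> K) x :
  L (fun i => c i *: x i) = \prod_i c i * L x.
Proof.
have := multilinear_scale c x (index_enum_uniq 'I_m).
by move=> <-; congr L; apply/funext => i; rewrite mem_index_enum.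
Qed.

End multilinear_forms.

(** * The polarization formula *)

Section polarization_formula.
Context {R : realType} {k : scalar_kind} {m : nat} {X : normedModType (scalars R k)}.
Local Notation K := (scalars R k).
Local Notation signs := {ffun 'I_m -> bool}.
Implicit Types (e : signs) (f : {ffun 'I_m -> 'I_m}).

(** Reindexing by [f] makes the two products equal, and signs square to 1. *)
Lemma sum_signs_inj f : injective f ->
  \sum_(e : signs) \prod_i (-1) ^+ e i * \prod_i (-1) ^+ e (f i) = #|{: signs}|%:R :> K.
Proof.
move=> finj; rewrite -sumr_const; apply: eq_bigr => e _.
rewrite [X in X * _](reindex_inj finj) -big_split/= big1// => i _.
by rewrite -expr2 sqrr_sign.
Qed.

Lemma sum_signs_notinj f : ~~ injectiveb f ->
  \sum_(e : signs) \prod_i (-1) ^+ e i * \prod_i (-1) ^+ e (f i) = 0 :> K.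
Proof.
(* Flipping the sign at a [j] outside the image of [f] negates the sum. *)
move=> fninj; have [j jf] : exists j, forall i, f i != j.
  suff /existsP[j /forallP jf] : [exists j, forall i, f i != j] by exists j.
  (* If every [j] is attained, a choice of preimages is injective, hence bijective on a finite set,
     and [f] is its inverse. *)
  apply: contraR fninj => /existsPn nf.
  have fsurj j : exists i, f i == j.
    by have /forallPn[i /negPn fij] := nf j; exists i.
  apply/injectiveP; pose g j := xchoose (fsurj j).
  have gK : cancel g f by move=> j; exact/eqP/(xchooseP (fsurj j)).
  have [h _ hK] : bijective g by exact: injF_bij (can_inj gK).
  by apply: (can_inj (g := g)) => i; rewrite -{1}(hK i) gK hK.
set S := (X in X = 0); suff : S = - S.
  by move/eqP; rewrite -addr_eq0 -mulr2n mulrn_eq0 /= => /eqP.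
rewrite /S -[LHS](sum_flip_sign j) -sumrN; apply: eq_bigr => e _.
have -> : \prod_i (-1) ^+ flip_sign j e (f i) = \prod_i (-1) ^+ e (f i) :> K.
  by apply: eq_bigr => i _; rewrite sign_flip (negbTE (jf i)) mul1r.
rewrite -mulNr; congr (_ * _).
rewrite !(bigD1 (P := predT) j)//= sign_flip eqxx mulN1r mulNr; congr (- (_ * _)).
by apply: eq_bigr => i /negbTE ij; rewrite sign_flip ij mul1r.
Qed.

(** After expansion over all maps [f], the sum over signs keeps only the injective ones; these are
    the [m!] permutations, and by symmetry each contributes [L x]. *)
Lemma polarization_formula (L : ('I_m -> X) -> K) (x : 'I_m -> X) :
  (0 < m)%N -> multilinear L -> Defs.symmetric_form L ->
  \sum_(e : signs) \prod_i (-1) ^+ e i *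
      polynomial_of L (\sum_i (-1) ^+ e i *: x i) =
  #|{: signs}|%:R * m`!%:R * L x.
Proof.
move=> m0 mL sL.
have expand e : polynomial_of L (\sum_i (-1) ^+ e i *: x i) =
    \sum_(f : {ffun 'I_m -> 'I_m}) \prod_i (-1) ^+ e (f i) * L (x \o f).
  rewrite /polynomial_of multilinear_sum_all ?card_ord//.
  by apply: eq_bigr => f _; rewrite multilinear_scale_all.
under eq_bigr do rewrite expand mulr_sumr.
rewrite exchange_big/=.
rewrite (eq_bigr (fun f : {ffun 'I_m -> 'I_m} => if injectiveb f then
    #|{: signs}|%:R * L x else 0)) => [|f _].
  rewrite -big_mkcond sumr_const /=.
  have := card_inj_ffuns 'I_m 'I_m; rewrite !card_ord ffactnn => <-.
  by rewrite cardsE -[LHS]mulr_natr mulrAC.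
under eq_bigr do rewrite mulrA; rewrite -mulr_suml.
case: ifPn => [/injectiveP finj|fninj]; last by rewrite sum_signs_notinj ?mul0r.
rewrite sum_signs_inj//; congr (_ * _).
by rewrite -(sL (perm finj) x); congr L; apply/funext => i /=; rewrite permE.
Qed.

End polarization_formula.

(** * From sign averages to the polarization constant *)

Section polarization_upper_bound.
Context {R : realType} {k : scalar_kind} {m : nat} {X : normedModType (scalars R k)}.
Local Notation K := (scalars R k).
Local Notation signs := {ffun 'I_m -> bool}.

Lemma modulus_sum (I : Type) (r : seq I) (F : I -> K) :
  modulus (\sum_(i <- r) F i) <= \sum_(i <- r) modulus (F i).
Proof.
elim: r => [|i r IH]; first by rewrite !big_nil modulus0.
by rewrite !big_cons (le_trans (ler_modulusD _ _))// lerD2l.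
Qed.

Lemma modulus_prod_sign (e : signs) (r : seq 'I_m) (z : K) :
  modulus (\prod_(i <- r) (-1) ^+ e i * z) = modulus z.
Proof.
elim: r => [|i r IH]; first by rewrite big_nil mul1r.
by rewrite big_cons -mulrA modulus_sign.
Qed.

Lemma modulus_natr n : modulus (n%:R : K) = n%:R.
Proof.
apply: (@of_real_inj R k); rewrite modulusE normr_nat.
elim: n => [|n IH]; first by rewrite of_real0.
by rewrite -!natr1 of_realD -IH; congr (_ + _); case: k.
Qed.

Lemma modulusX (z : K) n : modulus (z ^+ n) = modulus z ^+ n.
Proof.
elim: n => [|n IH]; first exact: (modulus_natr 1).
by rewrite !exprS modulusM IH.
Qed.

(** Homogeneity of degree [m] applied to the normalised vector; at [y = 0] the left side vanishes
    because [m > 0]. *)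
Lemma polynomial_of_le (L : ('I_m -> X) -> K) c y : (0 < m)%N -> multilinear L ->
  (forall x : X, `|x| <= 1 -> modulus (polynomial_of L x) <= c) ->
  modulus (polynomial_of L y) <= c * rnorm y ^+ m.
Proof.
move=> m0 mL Lc.
have LZ a (x : X) : polynomial_of L (a *: x) = a ^+ m * polynomial_of L x.
  by rewrite /polynomial_of multilinear_scale_all// prodr_const card_ord.
have [->|y0] := eqVneq y 0.
  rewrite -(scale0r (0 : X)) LZ expr0n gtn_eqF// mul0r modulus0.
  rewrite mulr_ge0 ?exprn_ge0 ?rnorm_ge0//.
  by rewrite (le_trans (modulus_ge0 _) (Lc 0 _))// normr0.
have ny0 : `|y| != 0 by rewrite normr_eq0.
rewrite -[in leLHS](scale1r y) -(divff ny0) -scalerA LZ modulusM modulusX.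
rewrite -rnorm_modulus mulrC ler_wpM2r ?exprn_ge0 ?rnorm_ge0//.
by apply: Lc; rewrite normrZ normfV normr_id mulVf.
Qed.

Lemma polarization_constant_le (c : R) : (0 < m)%N -> 0 < c ->
  (forall x : 'I_m -> X, (forall i, rnorm (x i) <= 1) ->
    \sum_(e : signs) rnorm (\sum_i (-1) ^+ e i *: x i) ^+ m <=
    #|{: signs}|%:R * (m`!%:R * c)) ->
  (polarization_constant m X <= c%:E)%E.
Proof.
move=> m0 c0 H; apply: ereal_inf_lbound; exists c => //; split=> // L [mL sL _].
(* The polynomial norm is an extended real: [+oo] makes the bound trivial as [c > 0], and [-oo] is
   excluded by the value at 0. *)
have [a0|a0] := boolP (polynomial_norm (polynomial_of L) == +oo%E).
  by rewrite (eqP a0) gt0_muley ?lte_fin// leey.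
have ub (x : X) : `|x| <= 1 ->
    ((modulus (polynomial_of L x))%:E <= polynomial_norm (polynomial_of L))%E.
  by move=> x1; apply: ereal_sup_ubound; exists x.
case: polynomial_norm ub a0 => [a| |] // ub _; last first.
  by have := ub 0; rewrite normr0 => /(_ ler01).
apply: ge_ereal_sup => _ [x /= x1 <-]; rewrite -EFinM lee_fin.
have N0 : 0 < #|{: signs}|%:R * m`!%:R :> R.
  by rewrite mulr_gt0// ltr0n ?fact_gt0// card_ffun card_bool expn_gt0.
rewrite -(ler_pM2l N0).
have := polarization_formula x m0 mL sL => /(congr1 (@modulus R k)).
rewrite !modulusM !modulus_natr => <-.
apply: (le_trans (modulus_sum _ _)).
under eq_bigr do rewrite modulus_prod_sign.
apply: (@le_trans _ _ (\sum_(e : signs) a * rnorm (\sum_i (-1) ^+ e i *: x i) ^+ m)).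
  apply: ler_sum => e _; exact: polynomial_of_le.
have age0 : 0 <= a.
  rewrite -lee_fin; apply: le_trans (ub 0 _); first by rewrite lee_fin modulus_ge0.
  by rewrite normr0.
rewrite -mulr_sumr mulrA [leRHS]mulrC ler_wpM2l//.
by rewrite -mulrA H// => i; rewrite rnorm_le1.
Qed.

End polarization_upper_bound.

(** * The upper bounds in the three ranges of [p] *)

Section upper_bounds.
Context {R : realType} (k : scalar_kind) (m : nat).
Hypothesis m2 : (2 <= m)%N.

Let m0 : (0 < m)%N. Proof. exact: leq_trans m2. Qed.
Let fact0 : 0 < m`!%:R :> R. Proof. by rewrite ltr0n fact_gt0. Qed.

Lemma hoelder_conjugate_fin (r : R) : 1 < r ->
  hoelder_conjugate r%:E = (r / (r - 1))%:E.
Proof.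
move=> r1; rewrite /hoelder_conjugate /= eqe gt_eqF; last lra.
by rewrite inver subr_eq0 gt_eqF.
Qed.

Lemma Lp_polarization_constant_le (p : \bar R) (p1 : (1 <= p)%E) (c : R) : 0 < c ->
  (forall d (T : measurableType d) (mu : {measure set T -> \bar R})
     (x : 'I_m -> Lp k mu p1), (forall i, rnorm (x i) <= 1) ->
    \sum_(e : {ffun 'I_m -> bool}) rnorm (\sum_i (-1) ^+ e i *: x i) ^+ m <=
    #|{ffun 'I_m -> bool}|%:R * c) ->
  (Lp_polarization_constant k m p1 <= (c / m`!%:R)%:E)%E.
Proof.
move=> c0 H; apply: ge_ereal_sup => _ [d [T [mu ->]]].
apply: polarization_constant_le => //; first by rewrite divr_gt0.
by move=> x x1; rewrite [_ * (c / _)]mulrC divfK ?gt_eqF// H.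
Qed.

Lemma Lp_polarization_constant_le_triangle (p : \bar R) (p1 : (1 <= p)%E) :
  (Lp_polarization_constant k m p1 <= (m%:R `^ m%:R / m`!%:R)%:E)%E.
Proof.
apply: Lp_polarization_constant_le => [|d T mu x x1].
  by rewrite powR_gt0 ?ltr0n.
rewrite powR_mulrn// mulr_natl -sumr_const; apply: ler_sum => e _.
apply: lerXn2r; rewrite ?nnegrE ?rnorm_ge0//.
apply: (@le_trans _ _ (\sum_i rnorm (x i))).
  elim/big_ind2: _ => [|u a v b ua vb|i _].
  - by rewrite rnorm_modulus normr0 modulus0.
  - exact: le_trans (ler_rnormD _ _) (lerD ua vb).
  - by rewrite rnormZ -[(-1) ^+ _]mulr1 modulus_sign (modulus_natr (k := k) 1) mul1r.
apply: (@le_trans _ _ (\sum_(i < m) 1)); first exact: ler_sum.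
by rewrite sumr_const card_ord.
Qed.

(** [Lp_rademacher] controls the mean of order [s]; the power mean inequality with exponent
    [s / m >= 1] descends to order [m], which gives the constant its exponent [m (s - 1) / s]. *)
Lemma Lp_polarization_constant_le_rademacher (p s : R) (p1 : (1 <= p%:E)%E) :
  m%:R <= s -> s / (s - 1) <= p -> p <= s ->
  (Lp_polarization_constant k m p1
    <= (m%:R `^ (m%:R * (s - 1) / s) / m`!%:R)%:E)%E.
Proof.
have m2R : 2 <= m%:R :> R by rewrite ler_nat.
move=> ms sp ps; have m0R : 0 < m%:R :> R by rewrite ltr0n.
have s2 : 2 <= s by exact: le_trans ms.
apply: Lp_polarization_constant_le => [|d T mu x x1]; first exact: powR_gt0.
have r1 : 1 <= s / m%:R by rewrite ler_pdivlMr// mul1r.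
apply: (power_mean r1); rewrite ?powR_ge0//.
  by move=> e; rewrite exprn_ge0 ?rnorm_ge0.
have := @Lp_rademacher _ k _ _ mu _ p1 'I_m s x.
rewrite card_ord => /(_ m0 s2 sp ps x1).
have -> : (m%:R `^ (m%:R * (s - 1) / s)) `^ (s / m%:R) = m%:R `^ (s - 1) :> R.
  by rewrite -powRrM; congr (_ `^ _); field; rewrite !gt_eqF//; lra.
apply: le_trans; apply: ler_sum => e _.
rewrite -powR_mulrn ?rnorm_ge0// -powRrM mulrCA divff ?mulr1//.
by rewrite gt_eqF.
Qed.

Lemma Lp_polarization_constant_le_low (p : \bar R) (p1 : (1 <= p)%E) :
  (1 <= p <= hoelder_conjugate m%:R%:E)%E ->
  (Lp_polarization_constant k m p1 <= (m%:R `^ (m%:R / fine p) / m`!%:R)%:E)%E.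
Proof.
have m2R : 2 <= m%:R :> R by rewrite ler_nat.
rewrite hoelder_conjugate_fin; last lra.
case: p p1 => [p| |] p1 /andP[_]; rewrite ?leye_eq// lee_fin /= => pm.
have := p1; rewrite lee_fin le_eqVlt => /predU1P[p1'|p1'].
  move: p1; rewrite -p1' => p1; rewrite divr1.
  exact: Lp_polarization_constant_le_triangle.
have m10 : 0 < m%:R - 1 :> R by lra.
have p10 : 0 < p - 1 by lra.
(* Here [s = p'], so [s' = p], and [p <= m'] amounts to [m <= s]. *)
have ms : m%:R <= p / (p - 1).
  by rewrite ler_pdivlMr//; move: pm; rewrite ler_pdivlMr//; lra.
have sE : p / (p - 1) - 1 = (p - 1)^-1 by field; rewrite gt_eqF.
have -> : m%:R / p = m%:R * (p / (p - 1) - 1) / (p / (p - 1)).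
  by rewrite sE; field; rewrite !gt_eqF//; lra.
apply: Lp_polarization_constant_le_rademacher => //.
- by rewrite sE invrK divfK// gt_eqF.
(* The chain is [p <= m' <= m <= s], with [m' <= m] because [m >= 2]. *)
- rewrite (le_trans _ ms)// (le_trans pm)// ler_pdivrMr//; nra.
Qed.

Lemma Lp_polarization_constant_le_middle (p : \bar R) (p1 : (1 <= p)%E) :
  (hoelder_conjugate m%:R%:E <= p <= m%:R%:E)%E ->
  (Lp_polarization_constant k m p1 <=
    (m%:R `^ (m%:R / fine (hoelder_conjugate m%:R%:E)) / m`!%:R)%:E)%E.
Proof.
have m2R : 2 <= m%:R :> R by rewrite ler_nat.
rewrite hoelder_conjugate_fin; last lra.
case: p p1 => [p| |] p1 /andP[]; rewrite ?leye_eq// !lee_fin /= => mp pm.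
rewrite invf_div mulrA.
exact: Lp_polarization_constant_le_rademacher.
Qed.

Lemma Lp_polarization_constant_le_high (p : \bar R) (p1 : (1 <= p)%E) :
  (m%:R%:E <= p)%E ->
  (Lp_polarization_constant k m p1 <=
    (m%:R `^ (m%:R / fine (hoelder_conjugate p)) / m`!%:R)%:E)%E.
Proof.
have m2R : 2 <= m%:R :> R by rewrite ler_nat.
case: p p1 => [p| |]// p1; last first.
  by move=> _ /=; rewrite divr1; exact: Lp_polarization_constant_le_triangle.
rewrite lee_fin => mp; rewrite hoelder_conjugate_fin; last lra.
rewrite /= invf_div mulrA.
apply: Lp_polarization_constant_le_rademacher => //.
by rewrite ler_pdivrMr; nra.
Qed.

End upper_bounds.

(** * The lower bound on the m-dimensional l_p *)

Lemma nonexpansive_continuous (F : numFieldType) (V : normedModType F) (f : V -> F) :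
  (forall x y, `|f x - f y| <= `|x - y|) -> continuous f.
Proof.
move=> fx x; apply/(@cvgrPdist_lt _ _ _ (nbhs x)) => e e0; near=> y.
apply: le_lt_trans (fx x y) _.
by near: y; exact: cvgr_dist_lt.
Unshelve. all: by end_near. Qed.

Lemma continuous_permanent (F : numFieldType) (V : topologicalType) (m : nat)
    (f : 'I_m -> V -> F) (c : F) : (forall i, continuous (f i)) ->
  continuous (fun x : prod_topology (fun _ : 'I_m => V) =>
    c * \sum_(s : 'S_m) \prod_i f i (x (s i))).
Proof.
move=> cf.
have cs : continuous (fun x : prod_topology (fun _ : 'I_m => V) =>
    \sum_(s : 'S_m) \prod_i f i (x (s i))).
  have := @continuous_big F 'S_m +%R 0 xpredT (@add_continuous F)
    (prod_topology (fun _ : 'I_m => V)) (index_enum 'S_m)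
    (fun s x => \prod_i f i (x (s i))).
  apply => s _.
  have := @continuous_big F 'I_m *%R 1 xpredT (@mul_continuous F)
    (prod_topology (fun _ : 'I_m => V)) (index_enum 'I_m)
    (fun i x => f i (x (s i))).
  apply => i _ x.
  apply: (@cvg_comp _ _ _ (fun y : prod_topology (fun _ : 'I_m => V) => y (s i)) (f i)).
    exact: (@proj_continuous _ (fun=> V) (s i)).
  exact: cf.
by move=> x; exact: (@cvgMl_tmp _ _ _ _ _ c _ (cs x)).
Qed.

Section lower_bound.
Context {R : realType} (k : scalar_kind) (m : nat).
Variables (p : R) (p1 : (1 <= p%:E)%E).
Local Notation K := (scalars R k).

(** Counting measure on the integers below [m]; all other integers form a null set, so its L_p space
    is the m-dimensional l_p. *)
Definition point_masses : {measure set nat -> \bar R} :=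
  msum (fun i => \d_i : {measure set nat -> \bar R}) m.

Local Notation lp := (Lp k point_masses p1).

Lemma integral_point_masses (f : nat -> R) : (forall i, 0 <= f i) ->
  (\int[point_masses]_t (f t)%:E = (\sum_(i < m) f i)%:E)%E.
Proof.
move=> f0; rewrite ge0_integral_measure_sum//; last by move=> i _; rewrite lee_fin.
rewrite -sumEFin; apply: eq_bigr => i _.
by rewrite integral_dirac// diracT mul1e.
Qed.

(** Each [i < m] is an atom of mass 1, hence lies in no null set. This makes coordinates independent
    of the representative. *)
Lemma ae_point_masses (P : nat -> Prop) :
  (\forall t \ae point_masses, P t) -> forall i : 'I_m, P i.
Proof.
move=> [A [mA A0 PA]] i; apply: contrapT => nPi.
have Ai : A i by exact: PA.
have : (\sum_(j < m) \d_(j : nat) A = 0 :> \bar R)%E by [].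
rewrite (bigD1 i)//= => /eqP; rewrite padde_eq0 ?sume_ge0// => /andP[+ _].
by rewrite diracE mem_set// onee_eq0.
Qed.

Definition coord (i : 'I_m) (x : lp) : K := Lp_repr x i.

Lemma coord_class i (f : Lp_fun k point_masses p%:E) :
  coord i (Lp_class p1 f) = f i.
Proof. exact: (ae_point_masses (Lp_repr_ae p1 f) i). Qed.

Lemma coord_linear i a (x y : lp) : coord i (a *: x + y) = a * coord i x + coord i y.
Proof.
rewrite -{1}(Lp_reprK x) -{1}(Lp_reprK y) -Lp_classZ -Lp_classD.
by rewrite coord_class.
Qed.

Lemma sum_coord (x : lp) : \sum_i modulus (coord i x) `^ p = rnorm x `^ p.
Proof.
apply: EFin_inj; rewrite -[in RHS](Lp_reprK x) -integral_Lp.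
by rewrite integral_point_masses// => i; rewrite powR_ge0.
Qed.

Let p0 : 0 < p. Proof. by rewrite (lt_le_trans ltr01)// -lee_fin. Qed.

Lemma modulus_coord_le i (x : lp) : modulus (coord i x) <= rnorm x.
Proof.
rewrite -(powRr1 (modulus_ge0 _)) -(powRr1 (rnorm_ge0 x)) -(@mulfV _ p) ?gt_eqF//.
rewrite !powRrM ge0_ler_powR ?nnegrE ?powR_ge0 ?invr_ge0 ?(ltW p0)//.
by rewrite -sum_coord (bigD1 i)//= lerDl sumr_ge0// => j _; rewrite powR_ge0.
Qed.

Lemma coord_continuous i : continuous (coord i).
Proof.
apply: nonexpansive_continuous => x y.
have -> : coord i x - coord i y = coord i (x - y).
  have -> : x - y = -1 *: y + x by rewrite scaleN1r addrC.
  by rewrite coord_linear mulN1r addrC.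
by rewrite -modulusE -of_real_rnorm ler_of_real modulus_coord_le.
Qed.

Lemma basis_fun_measurable (i : nat) :
  (fun j : nat => (i == j)%:R : K) \in Lp_pred k point_masses p%:E.
Proof.
rewrite inE /=; split; first by split.
rewrite /Lp_fnorm unlock /=.
rewrite integral_point_masses => [|j]; last exact: powR_ge0.
by rewrite poweR_EFin ltry.
Qed.

Definition basis_vec (i : 'I_m) : lp := Lp_class p1 (LpFun (basis_fun_measurable i)).

Lemma coord_basis i j : coord i (basis_vec j) = (j == i)%:R.
Proof. by rewrite coord_class. Qed.

Lemma rnorm_basis i : rnorm (basis_vec i) = 1.
Proof.
apply: (@powR_injective _ p) => //; rewrite ?nnegrE ?rnorm_ge0// powR1 -sum_coord.
rewrite (bigD1 i)//= coord_basis eqxx modulus_natr powR1 big1 ?addr0// => j ji.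
by rewrite coord_basis eq_sym (negbTE ji) modulus0 powR0// gt_eqF.
Qed.

(** On the diagonal all [m!] terms agree, so this normalisation makes the polynomial the product of
    the coordinates. *)
Definition permanent_form (x : 'I_m -> lp) : K :=
  m`!%:R^-1 * \sum_(s : 'S_m) \prod_i coord i (x (s i)).

Lemma permanent_form_multilinear : multilinear permanent_form.
Proof.
move=> x j a u v; rewrite /permanent_form mulrCA -mulrDr; congr (_ * _).
rewrite mulr_sumr -big_split/=; apply: eq_bigr => s _.
(* Slot [j] enters only through the factor of index [s^-1 j], in which the product is therefore
   linear. *)
have rest w : \prod_(i | i != (s^-1)%g j) coord i (dfwith x j w (s i)) =
    \prod_(i | i != (s^-1)%g j) coord i (x (s i)).
  apply: eq_bigr => i ij; rewrite dfwithout//.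
  by apply: contra ij => /eqP ->; rewrite permK.
rewrite !(bigD1 (P := predT) ((s^-1)%g j))//= !rest permKV !dfwithin coord_linear.
by rewrite mulrDl mulrA.
Qed.

Lemma permanent_form_symmetric : Defs.symmetric_form permanent_form.
Proof.
move=> t x; rewrite /permanent_form; congr (_ * _).
rewrite [RHS](reindex_inj (mulIg t)); apply: eq_bigr => s _.
by apply: eq_bigr => i _; rewrite permM.
Qed.

Lemma permanent_form_continuous :
  continuous (permanent_form : prod_topology (fun _ : 'I_m => lp) -> K).
Proof. exact: (@continuous_permanent K lp m coord (m`!%:R^-1) coord_continuous). Qed.

Lemma polynomial_permanent_form x :
  polynomial_of permanent_form x = \prod_i coord i x.
Proof.
rewrite /polynomial_of /permanent_form sumr_const card_Sn.
by rewrite -[X in _ * X]mulr_natl mulrA mulVf ?mul1r.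
Qed.

(** Only the identity contributes: any other permutation moves some [i], and the factor at that [i]
    is 0. *)
Lemma permanent_form_basis : permanent_form basis_vec = m`!%:R^-1.
Proof.
rewrite /permanent_form (bigD1 (1%g : 'S_m))//= [X in _ + X]big1 => [|s s1].
  rewrite addr0 big1 ?mulr1// => i _.
  by rewrite coord_basis perm1 eqxx.
have [i si] : exists i, s i != i.
  apply/existsP; apply: contraR s1 => /existsPn h; apply/eqP/permP => i.
  by rewrite perm1; apply/eqP/negPn/h.
by rewrite (bigD1 i)//= coord_basis (negbTE si) mul0r.
Qed.

Lemma powR_prod (I : Type) (r : seq I) (E : I -> R) (q : R) :
  (forall i, 0 <= E i) -> \prod_(i <- r) E i `^ q = (\prod_(i <- r) E i) `^ q.
Proof.
move=> E0; elim: r => [|i r IH]; first by rewrite !big_nil powR1.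
by rewrite !big_cons IH powRM// prodr_ge0.
Qed.

Lemma modulus_prod (I : Type) (r : seq I) (E : I -> K) :
  modulus (\prod_(i <- r) E i) = \prod_(i <- r) modulus (E i).
Proof.
elim: r => [|i r IH]; first by rewrite !big_nil (modulus_natr 1).
by rewrite !big_cons modulusM IH.
Qed.

(** The arithmetic-geometric mean inequality for the [|x_i|]^ p[, whose sum is at most 1, gives]P
    [^ p * m ^ m <= 1]; it remains to take [p]-th roots. *)
Lemma permanent_polynomial_le x : (0 < m)%N -> rnorm x <= 1 ->
  modulus (polynomial_of permanent_form x) <= m%:R `^ (- (m%:R / p)).
Proof.
move=> m0 x1; have m0R : 0 < m%:R :> R by rewrite ltr0n.
pose E i := modulus (coord i x) `^ p.
have [+ _] := @leif_AGM_scaled R 'I_m predT E (fun i _ => mulrn_wge0 _ (powR_ge0 _ _)).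
rewrite card_ord sum_coord => AGM.
rewrite polynomial_permanent_form modulus_prod.
set P := \prod_i _; have P0 : 0 <= P.
  by apply: prodr_ge0 => i _; exact: modulus_ge0.
have {AGM} Pm : P `^ p * m%:R ^+ m <= 1.
  rewrite -powR_prod; last by move=> i; exact: modulus_ge0.
  rewrite prodrMn_const card_ord in AGM.
  move: AGM; rewrite -natrX mulr_natr => /le_trans; apply.
  apply: exprn_ile1; rewrite ?powR_ge0//.
  have <- : (1 : R) `^ p = 1 by rewrite powR1.
  by apply: ge0_ler_powR; rewrite ?nnegrE ?rnorm_ge0 ?(ltW p0).
have -> : P = (P `^ p) `^ p^-1 by rewrite -powRrM mulfV ?gt_eqF// powRr1.
have -> : m%:R `^ (- (m%:R / p)) = (m%:R `^ (- m%:R)) `^ p^-1 :> R.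
  by rewrite -powRrM mulNr.
apply: ge0_ler_powR; rewrite ?nnegrE ?powR_ge0 ?invr_ge0 ?(ltW p0)//.
by rewrite powR_invn ?(ltW m0R)// -[leRHS]mul1r ler_pdivlMr ?exprn_gt0.
Qed.

Lemma Lp_polarization_constant_ge : (0 < m)%N ->
  ((m%:R `^ (m%:R / p) / m`!%:R)%:E <= Lp_polarization_constant k m p1)%E.
Proof.
move=> m0; have m0R : 0 < m%:R :> R by rewrite ltr0n.
apply: (@le_trans _ _ (polarization_constant m lp)); last first.
  apply: ereal_sup_ubound; by exists _, _, point_masses.
apply: le_ereal_inf_tmp => _ [M [M0 HM] <-].
have := HM permanent_form.
have /[swap]/[apply] H : continuous_symmetric_forms permanent_form.
  split; [exact: permanent_form_multilinear|exact: permanent_form_symmetric|].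
  exact: permanent_form_continuous.
have lo : ((m`!%:R^-1)%:E <= form_norm permanent_form)%E.
  apply: ereal_sup_ubound; exists basis_vec => /=.
    by move=> i; rewrite -rnorm_le1 rnorm_basis.
  rewrite permanent_form_basis; congr EFin; apply: (mulfI (x := m`!%:R)).
    by rewrite pnatr_eq0 -lt0n fact_gt0.
  rewrite -{1}(modulus_natr (k := k)) -modulusM !divff ?pnatr_eq0 -?lt0n ?fact_gt0//.
  exact: (modulus_natr 1).
have hi : (polynomial_norm (polynomial_of permanent_form) <=
    (m%:R `^ (- (m%:R / p)))%:E)%E.
  apply: ge_ereal_sup => _ [x /= x1 <-]; rewrite lee_fin.
  by apply: permanent_polynomial_le; rewrite ?rnorm_le1.
have M0E : (0 <= M%:E)%E by rewrite lee_fin ltW.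
have := le_trans lo (le_trans H (lee_wpmul2l M0E hi)).
rewrite -EFinM !lee_fin powRN ler_pdivlMr ?powR_gt0// => h.
by rewrite mulrC.
Qed.

End lower_bound.

(** * The three estimates and sharpness in the first range *)

Unset Implicit Arguments.

Theorem proposition11 (R : realType) (k : scalar_kind) (m : nat) (p : \bar R)
    (m2 : (2 <= m)%N) (p1 : (1 <= p)%E) :
  let m' := hoelder_conjugate (m%:R : R)%:E in
  let p' := hoelder_conjugate p in
  [/\ (1 <= p <= m')%E ->
        (Lp_polarization_constant k m p1
          <= (m%:R `^ (m%:R / fine p) / m`!%:R)%:E)%E,
      (m' <= p <= m%:R%:E)%E ->
        (Lp_polarization_constant k m p1
          <= (m%:R `^ (m%:R / fine m') / m`!%:R)%:E)%E,
      (m%:R%:E <= p <= +oo)%E ->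
        (Lp_polarization_constant k m p1
          <= (m%:R `^ (m%:R / fine p') / m`!%:R)%:E)%E
    & (1 <= p <= m')%E ->
        Lp_polarization_constant k m p1
          = (m%:R `^ (m%:R / fine p) / m`!%:R)%:E].
Proof.
move=> m' p'; split.
- exact: Lp_polarization_constant_le_low.
- exact: Lp_polarization_constant_le_middle.
- by move=> /andP[mp _]; exact: Lp_polarization_constant_le_high.
- move=> pm; apply/eqP; rewrite eq_le Lp_polarization_constant_le_low//=.
  have m0 : (0 < m)%N by exact: leq_trans m2.
  have m1 : 1 < m%:R :> R by rewrite ltr1n.
  move: pm; rewrite /m' hoelder_conjugate_fin// => /andP[_].
  (* Since [m'] is finite, [p <= m'] makes [p] a real number, to which the lower bound applies. *)
  case: p p1 {p'} => [p| |] p1; rewrite ?leye_eq// => _.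
  exact: Lp_polarization_constant_ge.
Qed.
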